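(* The $C(\lambda)$-typical function is weakly mixing; that is, there is a dense $G_\delta$ subset $G$ of the metric space $(C(\lambda),\rho)$ such that every $f\in G$ is weakly mixing with respect to $\lambda$.
   Context: $\lambda$ is the Lebesgue measure on $[0,1]$, $\mathcal B$ the Borel $\sigma$-algebra of $[0,1]$. $C(\lambda)$ is the set of all continuous maps $f\colon[0,1]\to[0,1]$ with $\lambda(A)=\lambda(f^{-1}(A))$ for all $A\in\mathcal B$, equipped with the complete metric $\rho(f,g)=\sup_{x\in[0,1]}|f(x)-g(x)|$. A map $f\in C(\lambda)$ is weakly mixing if for every $A,B\in\mathcal B$, $\lim_{n\to\infty}\frac1n\sum_{j=0}^{n-1}|\lambda(f^{-j}(A)\cap B)-\lambda(A)\lambda(B)|=0$. *)

(* Defs.v *)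
From HB Require Import structures.
From mathcomp Require Import all_boot all_order all_algebra.
From mathcomp Require Import all_classical all_reals all_analysis.

Set Implicit Arguments.
Unset Strict Implicit.
Unset Printing Implicit Defensive.

Import Order.TTheory GRing.Theory Num.Theory.
Import numFieldNormedType.Exports.

Local Open Scope classical_set_scope.
Local Open Scope ring_scope.

(* A [set_type], so it carries the library's subtype topology. *)
Notation unit_interval R := (set_type (`[0%R, 1%R]%classic : set R)).

Definition borel01 (R : realType) : set_system (unit_interval R) :=
  <<s [set A : set (unit_interval R) | open A] >>.

(* [fine] loses nothing: the image of [A] lies in [0, 1], so its measure is
   finite. *)
Definition lambda (R : realType) (A : set (unit_interval R)) : R :=
  fine (lebesgue_measure (set_val @` A)).

Record Clambda (R : realType) := MkClambda {
  Clambda_fun :> unit_interval R -> unit_interval R ;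
  Clambda_continuous : continuous Clambda_fun ;
  Clambda_preserving :
    forall A, borel01 A -> lambda A = lambda (Clambda_fun @^-1` A) }.

HB.instance Definition _ (R : realType) := gen_eqMixin (Clambda R).
HB.instance Definition _ (R : realType) := gen_choiceMixin (Clambda R).

Section sup_metric.
Context {R : realType}.
Implicit Types f g h : Clambda R.

Definition rho f g : R :=
  sup [set `|set_val (f x) - set_val (g x)| | x in [set: unit_interval R]].

Let zero01 : unit_interval R.
Proof. by exists 0; rewrite inE /= in_itv /= lexx ler01. Defined.

Let val01 (x : unit_interval R) : 0 <= set_val x <= 1.
Proof. by have := set_valP x; rewrite /= in_itv. Qed.

Lemma has_sup_rho f g :
  has_sup [set `|set_val (f x) - set_val (g x)| | x in [set: unit_interval R]].
Proof.
split; first by exists `|set_val (f zero01) - set_val (g zero01)|, zero01.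
exists 1 => _ [x _ <-].
have /andP[f0 f1] := val01 (f x); have /andP[g0 g1] := val01 (g x).
rewrite ler_norml; apply/andP; split.
  by rewrite lerBrDr (le_trans _ f0)// addrC subr_le0.
by rewrite lerBlDr (le_trans f1)// lerDl.
Qed.

Lemma le_rho f g x : `|set_val (f x) - set_val (g x)| <= rho f g.
Proof. by apply: ub_le_sup; [case: (has_sup_rho f g)|exists x]. Qed.

Lemma rho_le f g e :
  (forall x, `|set_val (f x) - set_val (g x)| <= e) -> rho f g <= e.
Proof.
by move=> fge; apply: ge_sup; [case: (has_sup_rho f g)|move=> _ [x _ <-]].
Qed.

Let rho_xx f : rho f f = 0.
Proof.
apply/eqP; rewrite eq_le (le_trans (normr_ge0 _) (le_rho f f zero01)) andbT.
by apply: rho_le => x; rewrite subrr normr0.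
Qed.

Let rho_positivity f g : rho f g = 0 -> f = g.
Proof.
move=> fg0; have fg : f = g :> (_ -> _).
  apply/funext => x; apply/val_inj/eqP; rewrite -subr_eq0 -normr_le0.
  by have := le_rho f g x; rewrite fg0.
case: f g fg {fg0} => [f cf pf] [g cg pg] /= fg; subst g.
by congr MkClambda; exact: Prop_irrelevance.
Qed.

Let rho_sym f g : rho f g = rho g f.
Proof.
by congr sup; apply/seteqP; split => _ [x _ <-]; exists x; rewrite 1?distrC.
Qed.

Let rho_triangle g f h : rho f h <= rho f g + rho g h.
Proof.
apply: rho_le => x; rewrite (le_trans (ler_distD (set_val (g x)) _ _))//.
by rewrite lerD// le_rho.
Qed.

HB.instance Definition _ := @isMetric.Build R (Clambda R)
  rho rho_xx rho_positivity rho_sym rho_triangle.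

End sup_metric.

Definition weakly_mixing (R : realType) (f : Clambda R) : Prop :=
  forall A B : set (unit_interval R), borel01 A -> borel01 B ->
  (fun n : nat => n%:R^-1 *
     \sum_(0 <= j < n)
       `|lambda ((iter j f @^-1` A) `&` B) - lambda A * lambda B|)
    @ \oo --> (0 : R).

(* Main.v *)
Require Import Defs.
From HB Require Import structures.
From mathcomp Require Import all_boot all_order all_algebra.
From mathcomp Require Import all_classical all_reals all_analysis borel_hierarchy.
From mathcomp Require Import measurable_realfun.
From mathcomp Require Import ring lra.

(** Write U_f for the composition operator u |-> u o f and u_A for the centered
indicator 1_A - lambda(A); scalar products are those of L2(lambda).  The plan
is to catch weak mixing by countably many conditions on f, each of them open
and dense, and to conclude by Baire's theorem.

_The conditions._  Suppose that for every j there is a period p such that the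
autocorrelations <U_f^(ip) u_A, u_A>, for 0 < i <= j, are all smaller than
1/(j+1).  Since U_f is an isometry, for every q the j+1 functions
U_f^(q+ip) u_A are almost orthogonal, so a Bessel inequality
([almost_orthogonal_sum]) makes the average over i of
|<U_f^(q+ip) u_A, k>| small, uniformly in q.  Averaging over q gives that
(1/n) sum_(s < n) |<U_f^s u_A, k>| tends to 0 ([cesaro_decorrelation]).  As a
function of u, this Cesaro mean is a seminorm bounded by the L1 norm, so it is
enough to have the limit for indicators of a generating pi-system
([null_generators]): the intervals [0, a[ with a rational suffice
([decorrelated_weakly_mixing]).  For A an interval, the s-th autocorrelation
depends continuously on f, whence openness ([open_decorrelated]).  The space
C(lambda) is complete ([Clambda_complete]), so only density is left.

_Density._  Given f, let g_m = f o psi_m o phi_m, where phi_m and psi_m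
preserve every block of the partitions of [0, 1] into N and N + 1 equal blocks
respectively, and run through each of them in 2m + 1 affine laps
([exists_zigzag]).  If N is large, all the g_m are close to f, by uniform
continuity.  When m grows, a lap of phi_m gets short while its image remains
spread evenly over a whole block, so U_(phi_m) tends weakly to the conditional
expectation E_N on the first partition; better, it sends bounded weakly
convergent sequences to weakly convergent sequences ([weak_folding_limit]).  So
does U_f ([weak_limit_comp]).  Therefore U_(g_m)^n u_A tends weakly to
(E_N E_(N+1) U_f)^n u_A.  The two partitions interleave, so E_N E_(N+1)
contracts the L2 norm of functions of mean zero by a factor that depends only
on N ([cond_exp_contraction]), and U_f neither increases the norm nor changes
the mean.  Choosing first a period p beyond which the limits are small, then m,
makes any prescribed number of autocorrelations of g_m at multiples of p small
([folded_autocorrelation]). *)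

Set Implicit Arguments.
Unset Strict Implicit.
Unset Printing Implicit Defensive.

Import Order.TTheory GRing.Theory Num.Theory.
Import numFieldNormedType.Exports.

Local Open Scope classical_set_scope.
Local Open Scope ring_scope.

(** * Bounded measurable functions on a probability space *)

Section bounded_functions.
Context d (T : measurableType d) (R : realType) (P : probability T R).
Implicit Types (u v k : T -> R) (A B : set T).

(** A class of test functions that is an algebra, stable under composition with
measurable maps, and on which integrability is automatic. *)
Definition bmeas u :=
  measurable_fun setT u /\ exists M, forall x, `|u x| <= M.

Definition mean u : R := \int[P]_x u x.

Lemma bmeas_cst (c : R) : bmeas (fun=> c).
Proof. by split; [exact: measurable_cst|exists `|c|]. Qed.

Lemma bmeasD u v : bmeas u -> bmeas v -> bmeas (fun x => u x + v x).
Proof.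
move=> [mu [M uM]] [mv [N vN]]; split; first exact: measurable_funD.
by exists (M + N) => x; rewrite (le_trans (ler_normD _ _))// lerD.
Qed.

Lemma bmeasM u v : bmeas u -> bmeas v -> bmeas (fun x => u x * v x).
Proof.
move=> [mu [M uM]] [mv [N vN]]; split; first exact: measurable_funM.
by exists (M * N) => x; rewrite normrM ler_pM.
Qed.

Lemma bmeasZ c u : bmeas u -> bmeas (fun x => c * u x).
Proof. by move=> bu; apply: bmeasM => //; exact: bmeas_cst. Qed.

Lemma bmeasB u v : bmeas u -> bmeas v -> bmeas (fun x => u x - v x).
Proof.
move=> bu bv; rewrite (_ : (fun x => _) = (fun x => u x + (-1) * v x)).
  by apply: bmeasD => //; exact: bmeasZ.
by apply/funext => x; rewrite mulN1r.
Qed.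

Lemma bmeas_norm u : bmeas u -> bmeas (fun x => `|u x|).
Proof.
move=> [mu [M uM]]; split; first exact: measurableT_comp.
by exists M => x; rewrite normr_id.
Qed.

Lemma bmeas_sum (n : nat) (F : nat -> T -> R) :
  (forall i, (i < n)%N -> bmeas (F i)) -> bmeas (fun x => \sum_(i < n) F i x).
Proof.
elim: n => [|n IH] bF.
  rewrite (_ : (fun x => _) = fun=> 0); first exact: bmeas_cst.
  by apply/funext => x; rewrite big_ord0.
rewrite (_ : (fun x => _) = fun x => \sum_(i < n) F i x + F n x); last first.
  by apply/funext => x; rewrite big_ord_recr.
by apply: bmeasD; [apply: IH => i /ltnW; exact: bF|exact: bF].
Qed.

Lemma bmeas_indic A : measurable A -> bmeas \1_A.
Proof.
move=> mA; split; first exact: measurable_indic.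
by exists 1 => x; rewrite indicE; case: (x \in A); rewrite ?normr1 ?normr0.
Qed.

Lemma bmeas_comp (F : T -> T) u :
  measurable_fun setT F -> bmeas u -> bmeas (fun x => u (F x)).
Proof.
by move=> mF [mu [M uM]]; split; [exact: measurableT_comp|exists M].
Qed.

Lemma bmeas_integrable u : bmeas u -> P.-integrable setT (EFin \o u).
Proof.
move=> [mu [M uM]]; apply: measurable_bounded_integrable => //.
  by rewrite (le_lt_trans (probability_le1 _ _))// ltry.
exists M; split; first exact: num_real.
by move=> N MN x _ /=; rewrite (le_trans (uM x))// ltW.
Qed.

Lemma eq_mean u v : u =1 v -> mean u = mean v.
Proof. by move=> /funext ->. Qed.

Lemma meanD u v : bmeas u -> bmeas v ->
  mean (fun x => u x + v x) = mean u + mean v.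
Proof. by move=> bu bv; rewrite /mean RintegralD//; exact: bmeas_integrable.
  Qed.

Lemma meanB u v : bmeas u -> bmeas v ->
  mean (fun x => u x - v x) = mean u - mean v.
Proof. by move=> bu bv; rewrite /mean RintegralB//; exact: bmeas_integrable.
  Qed.

Lemma meanZ c u : bmeas u -> mean (fun x => c * u x) = c * mean u.
Proof. by move=> bu; rewrite /mean RintegralZl//; exact: bmeas_integrable. Qed.

Lemma mean_cst (c : R) : mean (fun=> c) = c.
Proof. by rewrite /mean Rintegral_cst//= (@probability_setT _ _ _ P)/= mulr1.
  Qed.

Lemma mean_sum (n : nat) (F : nat -> T -> R) :
  (forall i, (i < n)%N -> bmeas (F i)) ->
  mean (fun x => \sum_(i < n) F i x) = \sum_(i < n) mean (F i).
Proof.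
elim: n => [|n IH] bF.
  by rewrite big_ord0 -[RHS]mean_cst; apply: eq_mean => x; rewrite big_ord0.
rewrite big_ord_recr/= -IH; last by move=> i /ltnW; exact: bF.
rewrite -meanD; [|by apply: bmeas_sum => i /ltnW; exact: bF|exact: bF].
by apply: eq_mean => x; rewrite big_ord_recr.
Qed.

Lemma mean_indic A : measurable A -> mean \1_A = fine (P A).
Proof.
by move=> mA; rewrite /mean /Rintegral integral_indic// setIT.
Qed.

Lemma mean_ge0 u : (forall x, 0 <= u x) -> 0 <= mean u.
Proof. by move=> u0; apply: Rintegral_ge0. Qed.

Lemma le_mean u v : bmeas u -> bmeas v -> (forall x, u x <= v x) ->
  mean u <= mean v.
Proof. by move=> bu bv uv; apply: le_Rintegral => //; exact: bmeas_integrable.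
  Qed.

Lemma norm_mean_le u : bmeas u -> `|mean u| <= mean (fun x => `|u x|).
Proof. by move=> bu; apply: le_normr_Rintegral => //; exact: bmeas_integrable.
  Qed.

Lemma norm_mean_bound u M : bmeas u -> (forall x, `|u x| <= M) -> `|mean u| <=
  M.
Proof.
move=> bu uM; rewrite (le_trans (norm_mean_le bu))// -[leRHS]mean_cst.
by apply: le_mean => //; [exact: bmeas_norm|exact: bmeas_cst].
Qed.

(** The quadratic form (s, t) |-> mean ((s u - t v) ^ 2) is nonnegative.  When
mean (v ^ 2) = 0, a nonzero mean (u v) would let it take the value -1. *)
Lemma mean_cauchy_schwarz u v : bmeas u -> bmeas v ->
  mean (fun x => u x * v x) ^+ 2 <=
  mean (fun x => u x ^+ 2) * mean (fun x => v x ^+ 2).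
Proof.
move=> bu bv.
set a := mean (fun x => u x ^+ 2); set c := mean _; set b := mean _.
have quad s t : 0 <= s ^+ 2 * a - 2 * s * t * c + t ^+ 2 * b.
  have buu : bmeas (fun x => u x ^+ 2) by exact: bmeasM.
  have bvv : bmeas (fun x => v x ^+ 2) by exact: bmeasM.
  have buv : bmeas (fun x => u x * v x) by exact: bmeasM.
  have <- : mean (fun x => (s * u x - t * v x) ^+ 2) =
      s ^+ 2 * a - 2 * s * t * c + t ^+ 2 * b.
    rewrite (@eq_mean _ (fun x => s ^+ 2 * u x ^+ 2 -
      2 * s * t * (u x * v x) + t ^+ 2 * v x ^+ 2)); last by move=> x; ring.
    rewrite meanD; [|by apply: bmeasB; apply: bmeasZ|by apply: bmeasZ].
    by rewrite meanB ?meanZ//; apply: bmeasZ.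
  by apply: mean_ge0 => x; exact: sqr_ge0.
have a0 : 0 <= a by apply: mean_ge0 => x; exact: sqr_ge0.
have b0 : 0 <= b by apply: mean_ge0 => x; exact: sqr_ge0.
have [b_eq0|bn0] := eqVneq b 0.
  have [->|cn0] := eqVneq c 0; first by rewrite expr0n/= mulr_ge0.
  have := quad 1 ((a + 1) / (2 * c)).
  have -> : 1 ^+ 2 * a - 2 * 1 * ((a + 1) / (2 * c)) * c +
    ((a + 1) / (2 * c)) ^+ 2 * b = -1 by rewrite b_eq0; field.
  by rewrite oppr_ge0 ler10.
have bp : 0 < b by rewrite lt_neqAle eq_sym bn0.
have := quad b c.
have -> : b ^+ 2 * a - 2 * b * c * c + c ^+ 2 * b = b * (a *
  b - c ^+ 2) by ring.
by rewrite pmulr_rge0// subr_ge0.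
Qed.

End bounded_functions.

(** * A Bessel inequality for almost orthogonal functions *)

Section bessel.
Context d (T : measurableType d) (R : realType) (P : probability T R).
Implicit Types (u v k : T -> R) (A B : set T).
Local Notation mean := (mean P).

(** Giving each v i the sign of its correlation with k turns the sum into one
scalar product <w, k>.  By Cauchy-Schwarz it remains to bound the norm of w: its
square has n diagonal terms, at most 1 each, and fewer than n ^ 2 others, at most
eta each. *)
Lemma almost_orthogonal_sum (v : nat -> T -> R) k eta n :
  (forall i, (i < n)%N -> bmeas (v i)) ->
  (forall i x, (i < n)%N -> `|v i x| <= 1) ->
  bmeas k -> (forall x, `|k x| <= 1) -> 0 <= eta ->
  (forall i j, (i < j)%N -> (j < n)%N ->
     `|mean (fun x => v i x * v j x)| <= eta) ->
  (\sum_(i < n) `|mean (fun x => v i x * k x)|) ^+ 2 <=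
    n%:R + eta * n%:R ^+ 2.
Proof.
move=> bv v1 bk k1 eta0 orth.
pose s i : R := Num.sg (mean (fun x => v i x * k x)).
pose w x := \sum_(i < n) s i * v i x.
have bw : bmeas w by apply: (@bmeas_sum _ _ _ _ (fun i x => s i * v i x)) =>
  i ni; exact/bmeasZ/bv.
have -> : \sum_(i < n) `|mean (fun x => v i x * k x)| =
    mean (fun x => w x * k x).
  rewrite (@eq_mean _ _ _ _ _ (fun x => \sum_(i < n) s i * (v i x * k x))).
    rewrite (@mean_sum _ _ _ _ _ (fun i x => s i * (v i x * k x))).
      apply: eq_bigr => i _; rewrite normrEsg meanZ//.
      by apply: bmeasM => //; exact: bv.
    by move=> i ni; apply/bmeasZ/bmeasM => //; exact: bv.
  by move=> x; rewrite /w mulr_suml; apply: eq_bigr => i _; rewrite mulrA.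
apply: (le_trans (mean_cauchy_schwarz P bw bk)).
have bkk : bmeas (fun x => k x ^+ 2) by apply: bmeasM.
have bww : bmeas (fun x => w x ^+ 2) by apply: bmeasM.
apply: (@le_trans _ _ (mean (fun x => w x ^+ 2))).
  rewrite ler_piMr//; first by apply: mean_ge0 => x; exact: sqr_ge0.
  rewrite -[leRHS](mean_cst P); apply: le_mean => //; first exact: bmeas_cst.
  by move=> x; rewrite -real_normK ?num_real// expr_le1.
have s1 i : `|s i| <= 1 by rewrite normr_sg; case: (_ == 0).
have bvv i j : (i < n)%N -> (j < n)%N ->
    bmeas (fun x => s i * s j * (v i x * v j x)).
  by move=> ni nj; apply/bmeasZ/bmeasM; exact: bv.
have -> : mean (fun x => w x ^+ 2) = \sum_(i < n) \sum_(j < n)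
    s i * s j * mean (fun x => v i x * v j x).
  rewrite (@eq_mean _ _ _ _ _ (fun x => \sum_(i < n) \sum_(j < n)
      s i * s j * (v i x * v j x))); last first.
    move=> x; rewrite expr2 big_distrlr/=; apply: eq_bigr => i _.
    by apply: eq_bigr => j _; ring.
  rewrite (@mean_sum _ _ _ _ _ (fun i x => \sum_(j < n)
      s i * s j * (v i x * v j x))); last first.
    move=> i ni; apply: (@bmeas_sum _ _ _ _ (fun j x => s i * s j * (v i x *
      v j x))) => j nj.
    exact: bvv.
  apply: eq_bigr => i _.
  rewrite (@mean_sum _ _ _ _ _ (fun j x => s i * s j * (v i x * v j x)));
    last first.
    by move=> j nj; exact: bvv.
  apply: eq_bigr => j _; rewrite meanZ//.
  by apply: bmeasM; exact: bv.
have corr (i j : 'I_n) : `|mean (fun x => v i x * v j x)| <= (i == j)%:R + eta.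
  case: (ltngtP i j) => [ij|ji|/val_inj ->].
  - by rewrite -val_eqE/= ltn_eqF// add0r orth.
  - rewrite -val_eqE/= gtn_eqF// add0r (@eq_mean _ _ _ _ _ (fun x => v j x *
    v i x)).
      exact: orth.
    by move=> x; rewrite mulrC.
  - rewrite eqxx (@le_trans _ _ 1) ?lerDl//.
    apply: norm_mean_bound => [|x]; first by apply: bmeasM; exact: bv.
    by rewrite normrM mulr_ile1// v1.
apply: (@le_trans _ _ (\sum_(i < n) \sum_(j < n) ((i == j)%:R + eta))).
  apply: ler_sum => i _; apply: ler_sum => j _.
  apply: (le_trans (ler_norm _)); rewrite 2!normrM.
  by rewrite (le_trans _ (corr i j))// ler_piMl// mulr_ile1.
rewrite (eq_bigr (fun=> 1 + eta * n%:R)).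
  by rewrite sumr_const card_ord -[(1 +
    _) *+ _]mulr_natr mulrDl mul1r expr2 mulrA.
move=> i _; rewrite big_split/= sumr_const card_ord mulr_natr; congr (_ + _).
rewrite (bigD1 i)//= eqxx big1 ?addr0// => j ji.
by rewrite eq_sym (negbTE ji).
Qed.

End bessel.

(** * Seminorms bounded by the L1 norm *)

Section seminorms.
Context d (T : measurableType d) (R : realType) (P : probability T R).
Implicit Types (u v k : T -> R) (A B : set T).
Local Notation mean := (mean P).

(** The bound by the L1 norm is what allows a convergence to 0 to pass from
simple functions to their L1 limits. *)
Definition L1_seminorm (C : R) (p : (T -> R) -> R) :=
  [/\ forall u v, bmeas u -> bmeas v -> p (fun x => u x + v x) <= p u + p v,
      forall c u, bmeas u -> p (fun x => c * u x) <= `|c| * p u &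
      forall u, bmeas u -> 0 <= p u <= C * mean (fun x => `|u x|)].

Section null.
Context (p : nat -> (T -> R) -> R) (C : R).
Context (pC : forall m, L1_seminorm C (p m)).
Let null u := bmeas u /\ p ^~ u @ \oo --> (0 : R).

Let nullD u v : null u -> null v -> null (fun x => u x + v x).
Proof.
move=> [bu u0] [bv v0]; split; first exact: bmeasD.
apply: (@squeeze_cvgr _ _ _ _ (fun=> 0) (fun m => p m u + p m v)).
- near=> m; have [pD _ pb] := pC m.
  by rewrite pD// andbT; have /andP[] := pb _ (bmeasD bu bv).
- exact: cvg_cst.
- by rewrite -[X in _ --> X]addr0; exact: cvgD.
Unshelve. all: by end_near. Qed.

Let nullZ c u : null u -> null (fun x => c * u x).
Proof.
move=> [bu u0]; split; first exact: bmeasZ.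
apply: (@squeeze_cvgr _ _ _ _ (fun=> 0) (fun m => `|c| * p m u)).
- near=> m; have [_ pZ pb] := pC m.
  by rewrite pZ// andbT; have /andP[] := pb _ (bmeasZ c bu).
- exact: cvg_cst.
- by rewrite -[X in _ --> X](mulr0 `|c|); exact: cvgMr.
Unshelve. all: by end_near. Qed.

Let null_sum n (F : nat -> T -> R) : null (fun=> 1) ->
  (forall i, null (F i)) -> null (fun x => \sum_(i < n) F i x).
Proof.
move=> n1 nF; elim: n => [|n IH].
  rewrite (_ : (fun _ => _) = fun x : T => 0 * 1); first exact: nullZ.
  by apply/funext => x; rewrite big_ord0 mul0r.
rewrite (_ : (fun _ => _) = fun x => \sum_(i < n) F i x + F n x).
  exact: nullD.
by apply/funext => x; rewrite big_ord_recr.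
Qed.

Let null_approx u : bmeas u ->
  (forall e, 0 < e -> exists2 v, null v & mean (fun x => `|u x - v x|) <= e) ->
  null u.
Proof.
move=> bu uv; split=> //.
apply/cvgrPdist_le => e e0.
have e1 : 0 < e / 2 / (`|C| + 1) by rewrite !divr_gt0// ltr_wpDl.
have [v [bv v0] uve] := uv _ e1.
have e2 : 0 < e / 2 by rewrite divr_gt0.
have /cvgrPdist_le/(_ _ e2) := v0.
apply: filterS => m; rewrite !sub0r !normrN => pve.
have [pD _ pb] := pC m.
have buv := bmeasB bu bv.
have /andP[pu0 _] := pb _ bu; rewrite ger0_norm//.
have -> : u = (fun x => (u x - v x) + v x) by apply/funext => x; rewrite subrK.
apply: (le_trans (pD _ _ buv bv)).
rewrite [leRHS](splitr e) lerD//; last by rewrite (le_trans (ler_norm _)).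
have /andP[_ /le_trans->//] := pb _ buv.
have h0 : 0 <= mean (fun x => `|u x - v x|) by exact: mean_ge0.
apply: (@le_trans _ _ ((`|C| + 1) * mean (fun x => `|u x - v x|))).
  by rewrite ler_wpM2r// (le_trans (ler_norm _))// lerDl.
by rewrite mulrC -ler_pdivlMr// ltr_wpDl.
Qed.

(** The functions u with p m u --> 0 form a vector space closed under L1 limits.
The sets whose indicator lies in it thus form a Dynkin class; once all measurable
sets are among them, uniform limits of simple functions do the rest. *)
Lemma null_generators (G : set (set T)) :
  @measurable _ T = <<s G >> -> setI_closed G ->
  p ^~ (fun=> 1) @ \oo --> (0 : R) ->
  (forall A, G A -> p ^~ \1_A @ \oo --> (0 : R)) ->
  forall u, bmeas u -> p ^~ u @ \oo --> (0 : R).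
Proof.
move=> GE GI p1 pG.
have null1 : null (fun=> 1) by split => //; exact: bmeas_cst.
have null_set A : measurable A -> null \1_A.
  rewrite {1}GE => sA; move: sA.
  apply: (@dynkin_induction _ _ G (fun A => null \1_A) GE GI).
  - rewrite (_ : \1_setT = fun=> 1)//.
    by apply/funext => x; rewrite indicE in_setT.
  - move=> B GB; split; last exact: pG.
    by apply: bmeas_indic; rewrite GE; exact: sub_gen_smallest.
  - move=> S mS nS.
    rewrite (_ : \1_(~` S) = (fun x => 1 + (-1) * \1_S x)).
      by apply: nullD => //; exact: nullZ.
    by apply/funext => x; rewrite !indicE in_setC mulN1r; case: (x \in S);
      rewrite /= ?subrr ?subr0.
  - move=> F mF tF nF.
    have mU : measurable (\bigcup_k F k) by exact: bigcupT_measurable.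
    apply: null_approx => [|e e0]; first exact: bmeas_indic.
    have cvF : (fun n => fine (\sum_(0 <= i < n) P (F i))%E) @ \oo -->
        fine (P (\bigcup_k F k)).
      apply: fine_cvg; rewrite fineK ?fin_num_measure//.
      exact: measure_semi_sigma_additive.
    have /cvgrPdist_le/(_ _ e0)[n _ /(_ n (leqnn n))] := cvF.
    rewrite /= => Pn.
    exists (fun x => \sum_(i < n) \1_(F i) x).
      by apply: (@null_sum n (fun i => \1_(F i))).
    have bs : bmeas (fun x => \sum_(i < n) \1_(F i) x : R).
      by apply: (@bmeas_sum _ _ _ _ (fun i => \1_(F i))) => i _;
        exact: bmeas_indic.
    have sumle x : \sum_(i < n) \1_(F i) x <= \1_(\bigcup_k F k) x :> R.
      have [/existsP[i Fix]|] := boolP [exists i : 'I_n, x \in F i].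
        rewrite (bigD1 i)//= big1 ?addr0 => [|j ji].
          rewrite !indicE Fix mem_set//.
          by exists i => //; exact/set_mem.
        rewrite indicE; case: (boolP (x \in F j)) => // Fjx.
        move: tF => /trivIsetP/(_ i j I I).
        rewrite eq_sym ji => /(_ isT)/seteqP[/(_ x)].
        by case; split; exact/set_mem.
      rewrite negb_exists => /forallP nF'.
      rewrite big1 => [|i _]; first by rewrite indicE; case: (_ \in _).
      by rewrite indicE (negbTE (nF' i)).
    rewrite (@eq_mean _ _ _ _ _ (fun x =>
        \1_(\bigcup_k F k) x - \sum_(i < n) \1_(F i) x)); last first.
      by move=> x; rewrite ger0_norm// subr_ge0.
    rewrite meanB//; last exact: bmeas_indic.
    rewrite (@mean_sum _ _ _ _ n (fun i => \1_(F i))); last first.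
      by move=> i _; exact: bmeas_indic.
    rewrite mean_indic// (eq_bigr (fun i : 'I_n => fine (P (F i)))); last first.
      by move=> i _; rewrite mean_indic.
    rewrite (le_trans (ler_norm _))//.
    rewrite big_mkord in Pn; rewrite -sum_fine// in Pn.
    by move=> i _; rewrite fin_num_measure.
move=> u bu.
suff: null u by case.
have [mu [M uM]] := bu.
have M1 : 0 < `|M| + 1 by rewrite ltr_wpDl.
pose v x := (u x + (`|M| + 1)) / (2 * (`|M| + 1)).
have mv : measurable_fun setT v.
  by apply: measurable_funM => //; apply: measurable_funD.
have v0 x : 0 <= v x.
  apply: divr_ge0; last by rewrite mulr_ge0// ltW.
  have := uM x; rewrite ler_norml => /andP[+ _].
  by have := ler_norm M; lra.
have v1 x : v x <= 1.
  rewrite ler_pdivrMr ?mulr_gt0// mul1r.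
  have := uM x; rewrite ler_norml => /andP[_].
  by have := ler_norm M; lra.
have bv : bmeas v.
  by split => //; exists 1 => x; rewrite ger0_norm.
have nv : null v.
  apply: null_approx => // e e0.
  have [n en] : exists n : nat, e^-1 < n.+1%:R.
    by exists (Num.truncn e^-1); exact: truncnS_gt.
  have mv_ge (c : R) : measurable [set x | c <= v x].
    have := mv measurableT `[c, +oo[%classic (measurable_itv _).
    rewrite setTI; congr measurable; apply/seteqP; split => x /=;
      by rewrite in_itv/= andbT.
  (* layer cake: at each point, the sum counts the i for which the value of v
     reaches i.+1 / n.+1, and so equals the integer part of n.+1 * v x *)
  exists (fun x => n.+1%:R^-1 *
      \sum_(i < n.+1) \1_[set x | i.+1%:R / n.+1%:R <= v x] x).
    apply: nullZ.
    apply: (@null_sum n.+1 (fun i =>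
      \1_[set x | i.+1%:R / n.+1%:R <= v x])) => // i.
    exact: null_set.
  rewrite -[leRHS](mean_cst P); apply: le_mean; [| exact: bmeas_cst|].
    apply: bmeas_norm; apply: bmeasB => //; apply: bmeasZ.
    apply: (@bmeas_sum _ _ _ _ (fun i =>
      \1_[set x | i.+1%:R / n.+1%:R <= v x])) => i _.
    exact: bmeas_indic.
  move=> x.
  have vn0 : 0 <= n.+1%:R * v x by rewrite mulr_ge0.
  have -> : \sum_(i < n.+1) \1_[set x | i.+1%:R / n.+1%:R <= v x] x =
      (Num.truncn (n.+1%:R * v x))%:R :> R.
    set t := Num.truncn _.
    have tn : (t <= n.+1)%N.
      rewrite -(@ler_nat R) (@le_trans _ _ (n.+1%:R * v x)) ?truncn_le//.
      by rewrite ler_piMr.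
    rewrite (eq_bigr (fun i : 'I_n.+1 => ((i < t)%N)%:R)); last first.
      move=> i _; rewrite indicE; congr (nat_of_bool _)%:R.
      apply/idP/idP => [/set_mem/=|it].
        by rewrite ler_pdivrMr// mulrC truncn_ge_nat.
      by apply/mem_set; rewrite /= ler_pdivrMr// mulrC -truncn_ge_nat.
    rewrite -natr_sum; congr _%:R.
    rewrite (eq_bigr (fun i : 'I_n.+1 => if (i < t)%N then 1%N else 0%N)).
      by rewrite -big_mkcond/= -(big_ord_widen _ (fun=> 1%N)
        tn) sum1_card card_ord.
    by move=> i _; case: (_ < _)%N.
  set t := Num.truncn _.
  have /andP[t1 t2] := truncn_itv vn0.
  have n0 : 0 < n.+1%:R :> R by [].
  have -> : v x - n.+1%:R^-1 * t%:R = (n.+1%:R * v x - t%:R) / n.+1%:R.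
    by rewrite mulrBl mulrAC mulfV ?lt0r_neq0// mul1r mulrC [_ / _]mulrC.
  rewrite ger0_norm; last by rewrite divr_ge0// subr_ge0.
  rewrite (@le_trans _ _ n.+1%:R^-1)//.
    by rewrite ler_piMl// lerBlDr addrC natr1 ltW.
  by rewrite -[leRHS]invrK lef_pV2 ?posrE ?invr_gt0// ltW.
rewrite (_ : u = fun x => 2 * (`|M| + 1) * v x + (- (`|M| + 1)) * 1).
  by apply: nullD; exact: nullZ.
apply/funext => x; rewrite /v; field.
by rewrite lt0r_neq0.
Qed.

End null.
End seminorms.

(** * Measure-preserving maps *)

Section measure_preserving.
Context d (T : measurableType d) (R : realType) (P : probability T R).
Implicit Types (u v k : T -> R) (A B : set T) (F : T -> T).
Local Notation mean := (mean P).

Definition preserving F :=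
  measurable_fun setT F /\ forall A, measurable A -> P (F @^-1` A) = P A.

Lemma preserving_iter F n : preserving F -> preserving (iter n F).
Proof.
move=> [mF PF]; elim: n => [|n [mFn PFn]]; first by split => //;
  exact: measurable_id.
split; first exact: (measurableT_comp mF mFn).
move=> A mA; rewrite (_ : _ @^-1` A = iter n F @^-1` (F @^-1` A))//.
rewrite PFn ?PF//.
by have := mF measurableT _ mA; rewrite setTI.
Qed.

Lemma mean_comp F u : preserving F -> bmeas u ->
  mean (fun x => u (F x)) = mean u.
Proof.
move=> [mF PF] bu; rewrite /mean /Rintegral; congr fine.
transitivity (\int[pushforward P F]_x (EFin \o u) x)%E.
  rewrite integral_pushforward//.
  - by apply/measurable_EFinP; case: bu.
  - by rewrite preimage_setT; apply: (bmeas_integrable P (bmeas_comp mF bu)).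
by apply: eq_measure_integral => A mA _; exact: PF.
Qed.

Lemma mean_iter_shift F u v i j q : preserving F -> bmeas u -> bmeas v ->
  mean (fun x => u (iter (q + i) F x) * v (iter (q + j) F x)) =
  mean (fun x => u (iter i F x) * v (iter j F x)).
Proof.
move=> pF bu bv.
have [mi mj] := ((preserving_iter i pF).1, (preserving_iter j pF).1).
rewrite -(@mean_comp (iter q F) (fun x => u (iter i F x) * v (iter j F x))).
- by apply: eq_mean => x; rewrite -!iterD ![(_ + q)%N]addnC.
- exact: preserving_iter.
- by apply: bmeasM; apply: bmeas_comp.
Qed.

Let sum_shift (b : nat -> R) K r : (forall s, 0 <= b s <= 1) ->
  \sum_(0 <= s < K) b s <= r%:R + \sum_(0 <= q < K) b (q + r)%N.
Proof.
move=> b01.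
apply: (@le_trans _ _ (\sum_(0 <= s < r + K) b s)).
  rewrite (@big_cat_nat _ _ _ K 0 (r + K))//= ?leq_addl// lerDl.
  by apply: sumr_ge0 => s _; have /andP[] := b01 s.
rewrite (@big_cat_nat _ _ _ r 0 (r + K))//= ?leq_addr// lerD//.
  rewrite (@le_trans _ _ (\sum_(0 <= s < r) 1))//.
    by apply: ler_sum => s _; have /andP[] := b01 s.
  by rewrite sumr_const_nat subn0.
by rewrite -{1}[r]add0n big_addn addKn.
Qed.

(** For every q, the functions u o F ^ (q + i p) with i < n are almost orthogonal,
because F preserves the mean of their products; hence their correlations with k
are small on average.  Summing over q < K compares these averages with a Cesaro
mean of length K, up to at most i p boundary terms for each i. *)
Lemma cesaro_decorrelation F u k : preserving F ->
  bmeas u -> (forall x, `|u x| <= 1) -> bmeas k -> (forall x, `|k x| <= 1) ->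
  (forall j, exists p, forall i, (0 < i <= j)%N ->
     `|mean (fun x => u (iter (i * p) F x) * u x)| <= j.+1%:R^-1) ->
  (fun n => n%:R^-1 *
     \sum_(0 <= s < n) `|mean (fun x => u (iter s F x) *
       k x)|) @ \oo --> (0 : R).
Proof.
move=> pF bu u1 bk k1 decorr.
pose b s := `|mean (fun x => u (iter s F x) * k x)|.
have bui i : bmeas (fun x => u (iter i F x)).
  by apply: bmeas_comp => //; exact: (preserving_iter i pF).1.
have b01 s : 0 <= b s <= 1.
  rewrite normr_ge0/=; apply: norm_mean_bound => [|x]; first exact: bmeasM.
  by rewrite normrM mulr_ile1.
apply/cvgrPdist_le => e e0.
(* so that the bound 2 * n given by almost orthogonality, with eta = 1 / n, is at
   most (e / 2 * n) ^ 2 *)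
pose j := Num.truncn (8 / e ^+ 2).
pose n := j.+1.
have n0 : 0 < n%:R :> R by [].
have en : 2 * n%:R <= (e / 2 * n%:R) ^+ 2.
  have : 8 / e ^+ 2 < n%:R by exact: truncnS_gt.
  rewrite ltr_pdivrMr ?exprn_gt0// => /ltW h.
  have -> : (e / 2 * n%:R) ^+ 2 = n%:R * e ^+ 2 / 4 * n%:R by field.
  by rewrite ler_wpM2r// ler_pdivlMr//; lra.
have [p dp] := decorr j.
have window q : \sum_(i < n) b (q + i * p)%N <= e / 2 * n%:R.
  rewrite -ler_sqr ?nnegrE; first last.
  - by rewrite mulr_ge0// divr_ge0// ltW.
  - by apply: sumr_ge0 => i _; exact: normr_ge0.
  apply: le_trans en.
  have -> : 2 * n%:R = n%:R + n%:R^-1 * n%:R ^+ 2 :> R.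
    by rewrite expr2 mulKf ?lt0r_neq0// mulr_natl mulr2n.
  apply: (@almost_orthogonal_sum _ _ _ P (fun i x => u (iter (q + i *
    p) F x))) => //.
  move=> i l il ln.
  rewrite mean_iter_shift// (_ : l * p = i * p + (l - i) * p)%N; last first.
    by rewrite -mulnDl subnKC// ltnW.
  rewrite -{1}[(i * p)%N]addn0 mean_iter_shift//.
  rewrite (@eq_mean _ _ _ _ _ (fun x => u (iter ((l - i) * p) F x) * u x)).
    apply: dp; rewrite subn_gt0 il/=.
    by rewrite (leq_trans (leq_subr _ _)).
  by move=> x; rewrite /= mulrC.
pose K0 := Num.truncn (2 * (n%:R * p%:R) / e).
exists K0.+1 => // K /= K0K.
have K_gt0 : 0 < K%:R :> R by rewrite ltr0n (leq_trans _ K0K).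
have KK : 2 * (n%:R * p%:R) / e <= K%:R.
  apply/ltW/(lt_le_trans (truncnS_gt _)).
  by rewrite ler_nat.
rewrite sub0r normrN ger0_norm; last first.
  by rewrite mulr_ge0 ?invr_ge0// sumr_ge0.
rewrite mulrC ler_pdivrMr//.
rewrite -(ler_pM2l n0).
rewrite -/(b _).
have -> : n%:R * \sum_(0 <= s < K) b s = \sum_(i < n) \sum_(0 <= s < K) b s.
  by rewrite sumr_const card_ord mulr_natl.
apply: (@le_trans _ _ (\sum_(i < n) ((n * p)%:R + \sum_(0 <= q < K) b (q + i *
  p)%N))).
  apply: ler_sum => i _; apply: (le_trans (sum_shift K (i * p) b01)).
  by rewrite lerD2r ler_nat leq_mul2r ltnW ?orbT.
rewrite big_split/= sumr_const card_ord -[_ *+ n]mulr_natl exchange_big/=.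
have -> : n%:R * (e * K%:R) = n%:R * (e / 2 * K%:R) + \sum_(0 <= q < K) e / 2 *
  n%:R.
  by rewrite sumr_const_nat subn0 -[X in _ = _ + X]mulr_natl; field.
apply: lerD; last by apply: ler_sum => q _; exact: window.
rewrite ler_pM2l//.
rewrite natrM; move: KK; rewrite ler_pdivrMr// => KK.
lra.
Qed.

(** The Cesaro means defining weak mixing fall under [null_generators]; this is
how they are controlled for all Borel sets once they are for intervals. *)
Lemma cesaro_seminorm F k : preserving F -> bmeas k -> (forall x, `|k x| <=
  1) ->
  forall n, L1_seminorm P 2 (fun u => n%:R^-1 *
    \sum_(0 <= s < n) `|mean (fun x => u (iter s F x) * k x) - mean u *
      mean k|).
Proof.
move=> pF bk k1 n.
have buk u s : bmeas u -> bmeas (fun x => u (iter s F x) * k x).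
  move=> bu; apply: bmeasM => //; apply: bmeas_comp => //.
  exact: (preserving_iter s pF).1.
have n0 : 0 <= n%:R^-1 :> R by rewrite invr_ge0.
split.
- move=> u v bu bv; rewrite -mulrDr ler_wpM2l// -big_split/=.
  apply: ler_sum => s _.
  rewrite meanD// (@eq_mean _ _ _ _ _ (fun x =>
    u (iter s F x) * k x + v (iter s F x) * k x)); last by move=> x;
      rewrite mulrDl.
  rewrite meanD; [|exact: buk..].
  rewrite mulrDl opprD addrACA; exact: ler_normD.
- move=> c u bu; rewrite mulrCA ler_wpM2l// mulr_sumr ler_sum// => s _.
  rewrite -normrM mulrBr meanZ// (@eq_mean _ _ _ _ _ (fun x =>
    c * (u (iter s F x) * k x))); last by move=> x; rewrite mulrA.
  by rewrite meanZ ?mulrA//; exact: buk.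
- move=> u bu; apply/andP; split; first by rewrite mulr_ge0// sumr_ge0.
  have m0 : 0 <= mean (fun x => `|u x|) by exact: mean_ge0.
  have [->|n_gt0] := eqVneq n 0%N; first by rewrite invr0 mul0r mulr_ge0.
  rewrite mulrC ler_pdivrMr ?ltr0n ?lt0n//.
  apply: (@le_trans _ _ (\sum_(0 <= s < n) (2 * mean (fun x => `|u x|)))).
    apply: ler_sum => s _; apply: (le_trans (ler_normB _ _)).
    rewrite mulr_natl mulr2n lerD//; last first.
      rewrite normrM (le_trans _ (norm_mean_le P bu))// ler_piMr//.
      exact: norm_mean_bound.
    rewrite (le_trans (norm_mean_le P (buk _ _ bu)))//.
    rewrite -(mean_comp (preserving_iter s pF) (bmeas_norm bu)).
    apply: le_mean.
    + by apply: bmeas_norm; exact: buk.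
    + by apply: bmeas_comp (bmeas_norm bu); exact: (preserving_iter s pF).1.
    + by move=> x; rewrite normrM ler_piMr.
  by rewrite sumr_const_nat subn0 mulr_natr.
Qed.

Definition weakly_null (r : nat -> T -> R) := forall k, bmeas k ->
  (fun m => mean (fun x => r m x * k x)) @ \oo --> (0 : R).

(** Composition with F is a bounded operator of L2, hence weakly continuous.  The
argument is that of Banach and Saks: if the
correlations of r m o F with k did not tend to 0, some arbitrarily long family of
almost orthogonal r m would have all of them larger than a fixed e; the r m o F
being equally orthogonal, this contradicts [almost_orthogonal_sum]. *)
Lemma weakly_null_comp F (r : nat -> T -> R) : preserving F ->
  (forall m, bmeas (r m)) -> (forall m x, `|r m x| <= 1) ->
  weakly_null r -> weakly_null (fun m x => r m (F x)).
Proof.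
move=> pF br r1 r0.
suff unit_ball k : bmeas k -> (forall x, `|k x| <= 1) ->
    (fun m => mean (fun x => r m (F x) * k x)) @ \oo --> (0 : R).
  move=> k bk; have [_ [M kM]] := bk.
  have M0 : 0 < `|M| + 1 by rewrite ltr_wpDl.
  have brk m : bmeas (fun x => r m (F x) * ((`|M| + 1)^-1 * k x)).
    by apply: bmeasM; [exact: bmeas_comp pF.1 _|exact: bmeasZ].
  rewrite (_ : (fun m => _) = fun m => (`|M| + 1) *
      mean (fun x => r m (F x) * ((`|M| + 1)^-1 * k x))); last first.
    apply/funext => m; rewrite -meanZ//; apply: eq_mean => x.
    by rewrite mulrCA mulVKf// lt0r_neq0.
  rewrite -[X in _ --> X](mulr0 (`|M| + 1)); apply: cvgMr.
  apply: unit_ball; first exact: bmeasZ.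
  move=> x; rewrite normrM normfV (ger0_norm (ltW M0)) mulrC ler_pdivrMr//
    mul1r.
  by rewrite (le_trans (kM x))// (le_trans (ler_norm _))// lerDl.
move=> bk k1; apply/cvgrPdist_le => e e0; apply: contrapT => not_near.
have often N : exists2 m, (N <= m)%N & e < `|mean (fun x => r m (F x) * k x)|.
  apply: contrapT => noN; apply: not_near; exists N => // m /= Nm.
  rewrite sub0r normrN leNgt; apply/negP => em.
  by apply: noN; exists m.
pose eta := e ^+ 2 / 2.
have eta0 : 0 < eta by rewrite divr_gt0// exprn_gt0.
have build n : exists s : nat -> nat,
    (forall i, (i < n)%N -> e < `|mean (fun x => r (s i) (F x) * k x)|) /\
    (forall i j, (i < j)%N -> (j < n)%N ->
       `|mean (fun x => r (s i) x * r (s j) x)| <= eta).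
  elim: n => [|n [s [s1 s2]]]; first by exists id.
  have /= [N _ NP] : \forall m \near \oo, forall i : 'I_n,
      `|mean (fun x => r m x * r (s i) x)| <= eta.
    apply: filter_forall => i; have /cvgrPdist_le/(_ _ eta0) := r0 _ (br (s i)).
    by apply: filterS => m; rewrite sub0r normrN.
  have [m Nm em] := often N.
  exists (fun i => if (i < n)%N then s i else m); split=> [i|i j ij].
    by rewrite ltnS => _; case: ifPn => // ni; exact: s1.
  rewrite ltnS => jn; rewrite (leq_trans ij jn).
  move: jn; rewrite leq_eqVlt => /predU1P[jn|jn].
    rewrite jn ltnn; rewrite jn in ij.
    rewrite (@eq_mean _ _ _ _ _ (fun x => r m x * r (s i) x)).
      exact: (NP m Nm (Ordinal ij)).
    by move=> x; rewrite mulrC.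
  by rewrite jn; exact: s2.
pose n := (Num.truncn (2 / e ^+ 2)).+1.
have [s [s1 s2]] := build n.
have n0 : 0 < n%:R :> R by [].
have : (\sum_(i < n) `|mean (fun x => r (s i) (F x) * k x)|) ^+ 2 <=
    n%:R + eta * n%:R ^+ 2.
  apply: (@almost_orthogonal_sum _ _ _ P (fun i x => r (s i) (F x))) => //.
  - by move=> i _; exact: bmeas_comp pF.1 _.
  - exact: ltW.
  - move=> i j ij jn; rewrite (mean_comp (u := fun x => r (s i) x *
    r (s j) x))//.
      exact: s2.
    exact: bmeasM.
apply/negP; rewrite -ltNge.
apply: (@lt_le_trans _ _ ((e * n%:R) ^+ 2)).
  have : 2 / e ^+ 2 < n%:R by exact: truncnS_gt.
  rewrite ltr_pdivrMr ?exprn_gt0// => h.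
  have -> : (e * n%:R) ^+ 2 = n%:R * (n%:R * e ^+ 2 / 2) + eta * n%:R ^+ 2.
    by rewrite /eta; field.
  by rewrite ltrD2r ltr_pMr// ltr_pdivlMr// mul1r.
have en0 : 0 <= e * n%:R by rewrite mulr_ge0// ltW.
rewrite ler_sqr ?nnegrE//; last by apply: sumr_ge0 => i _; exact: normr_ge0.
rewrite (@le_trans _ _ (\sum_(i < n) e))//.
  by rewrite sumr_const card_ord mulr_natr.
by apply: ler_sum => i _; apply/ltW/s1.
Qed.

End measure_preserving.

(** * The unit interval as a probability space *)

Section unit_interval.
Context {R : realType}.

(** An alias, so that the Borel sets can be declared as its canonical
sigma-algebra. *)
Definition I01 := unit_interval R.

Lemma val01 (x : I01) : 0 <= set_val x <= 1.
Proof. by have := set_valP x; rewrite /= in_itv. Qed.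

Definition clamp01 (t : R) : R := Num.min 1 (Num.max 0 t).

Lemma clamp01_id t : 0 <= t <= 1 -> clamp01 t = t.
Proof. by move=> /andP[t0 t1]; rewrite /clamp01 max_r// min_r. Qed.

Lemma clamp01_itv t : clamp01 t \in `[0%R, 1%R]%classic.
Proof.
apply/mem_set; rewrite /= in_itv/= /clamp01 le_min ler01 le_max lexx.
by rewrite ge_min lexx.
Qed.

Definition proj01 (x : R) : I01 := exist _ (clamp01 x) (clamp01_itv x).

Lemma proj01K x : 0 <= x <= 1 -> set_val (proj01 x) = x.
Proof. exact: clamp01_id. Qed.

HB.instance Definition _ := Choice.on I01.
HB.instance Definition _ := isPointed.Build I01 (proj01 0).

Let borel0 : @borel01 R set0. Proof. exact: sigma_algebra0. Qed.
Let borelC A : @borel01 R A -> @borel01 R (~` A).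
Proof. by rewrite -setTD; exact: sigma_algebraCD. Qed.
Let borelU (F : (set I01)^nat) :
  (forall i, @borel01 R (F i)) -> @borel01 R (\bigcup_i F i).
Proof. exact: sigma_algebra_bigcup. Qed.

HB.instance Definition _ := @isMeasurable.Build default_measure_display
  I01 (@borel01 R) borel0 borelC borelU.

Lemma measurable_borel01 : (measurable : set_system I01) = @borel01 R.
Proof. by []. Qed.

Lemma open_unit_interval (A : set (unit_interval R)) :
  open A <-> exists2 O : set R, open O & set_val @^-1` O = A.
Proof. by []. Qed.

(** Since lambda measures images in the real line, its countable additivity rests
on the measurability of those images. *)
Lemma borel01_image (A : set I01) : measurable A -> measurable (set_val @` A :
  set R).
Proof.
rewrite measurable_borel01.
pose S : set_system I01 := [set A | measurable (set_val @` A : set R)].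
suff: @borel01 R `<=` S by exact.
apply: smallest_sub => [|B /open_unit_interval[U oU <-]]; last first.
  rewrite /S/= (_ : _ @` _ = U `&` `[0, 1]).
    by apply: measurableI => //; exact: open_measurable.
  apply/seteqP; split=> [_ [x Ux <-]|y [Uy y01]].
    by split => //; have := val01 x; rewrite /= in_itv.
  exists (proj01 y); rewrite /= proj01K//; move: y01; by rewrite /= in_itv.
split; rewrite /S/=.
- by rewrite image_set0.
- move=> B mB; rewrite setTD (_ : _ @` _ = `[0, 1] `\` (set_val @` B)).
    exact: measurableD.
  apply/seteqP; split=> [_ [x nBx <-]|y [y01 nBy]].
    split; first by have := val01 x; rewrite /= in_itv.
    by move=> [z Bz] /val_inj zx; apply: nBx; rewrite -zx.
  have yK : set_val (proj01 y) = y by rewrite proj01K//; move: y01;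
    rewrite /= in_itv.
  by exists (proj01 y) => // By; apply: nBy; exists (proj01 y).
- move=> F mF; rewrite image_bigcup; exact: bigcupT_measurable.
Qed.

Definition mu01 (A : set I01) : \bar R := lebesgue_measure (set_val @` A).

Let mu0 : mu01 set0 = 0%E. Proof. by rewrite /mu01 image_set0 measure0. Qed.
Let mu_ge0 A : (0 <= mu01 A)%E. Proof. exact: measure_ge0. Qed.
Let mu_sigma : semi_sigma_additive mu01.
Proof.
move=> F mF tF mU; rewrite /mu01 image_bigcup.
apply: measure_semi_sigma_additive.
- by move=> i; exact: borel01_image.
- apply/trivIsetP => i j _ _ ij; apply/seteqP; split => // _ [[x Fx <-] [y Fy]].
  move=> /val_inj yx; rewrite yx in Fy.
  by have /trivIsetP/(_ i j I I ij)/seteqP[+ _] := tF; move=> /(_ x); apply.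
- by rewrite -image_bigcup; exact: borel01_image.
Qed.

HB.instance Definition _ := isMeasure.Build _ _ _ mu01 mu0 mu_ge0 mu_sigma.

Lemma mu01_preimage (B : set R) :
  mu01 (set_val @^-1` B) = lebesgue_measure (B `&` `[0, 1]).
Proof.
congr (lebesgue_measure _); apply/seteqP; split=> [_ [x Bx <-]|y [By y01]].
  by split => //; have := val01 x; rewrite /= in_itv.
exists (proj01 y); rewrite /= proj01K//; move: y01; by rewrite /= in_itv.
Qed.

Let mu01T : mu01 setT = 1%E.
Proof.
rewrite -(preimage_setT (set_val : I01 -> R)) mu01_preimage setTI.
by rewrite lebesgue_measure_itv/= lte_fin ltr01 oppr0 adde0.
Qed.

HB.instance Definition _ := Measure_isProbability.Build _ _ _ mu01 mu01T.

Lemma lambdaE (A : set I01) : lambda A = fine (mu01 A).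
Proof. by []. Qed.

Lemma lambda_itv (s t : bool) (a b : R) : 0 <= a -> a <= b -> b <= 1 ->
  lambda [set x : I01 | set_val x \in Interval (BSide s a) (BSide t b)] = b - a.
Proof.
move=> a0 ab b1.
rewrite lambdaE (_ : [set x | _] =
  set_val @^-1` [set` Interval (BSide s a) (BSide t b)])//.
rewrite mu01_preimage setIidl.
  rewrite lebesgue_measure_itv/= lte_fin; case: ltP => [_|ba]//=.
  by apply/esym/eqP; rewrite subr_eq0 eq_le ab ba.
move=> x /=; rewrite !in_itv/= => /andP[ax xb]; apply/andP; split.
  by apply: (le_trans a0); case: s ax => //= /ltW.
by apply: le_trans b1; case: t xb => //= /ltW.
Qed.

(** A generating pi-system; the bounds are rational in order to leave only
countably many conditions to impose on a generic map. *)
Definition rays : set_system I01 :=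
  [set [set x | set_val x < ratr q :> R] | q in [set: rat]].

Lemma setI_closed_rays : setI_closed rays.
Proof.
move=> _ _ [p _ <-] [q _ <-]; exists (Order.min p q) => //.
apply/seteqP; split => x /=.
  by rewrite minEle; case: ifP => pq; move=> xp; split => //;
    rewrite (lt_le_trans xp)// ler_rat// ltW// ltNge pq.
by move=> [xp xq]; rewrite minEle; case: ifP.
Qed.

Lemma open_ray (a : R) : open ([set x | set_val x < a] : set (unit_interval R)).
Proof.
apply/open_unit_interval; exists `]-oo, a[%classic; first exact: interval_open.
by apply/seteqP; split => x /=; rewrite in_itv.
Qed.

Lemma measurable_rays : (measurable : set_system I01) = <<s rays >>.
Proof.
apply/seteqP; split; last first.
  apply: smallest_sub; first exact: sigma_algebra_measurable.
  by move=> _ [q _ <-]; apply: sub_sigma_algebra; exact: open_ray.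
apply: smallest_sub => [|B /open_unit_interval[U oU <-]].
  exact: smallest_sigma_algebra.
pose S := g_sigma_algebraType rays.
have mval : measurable_fun [set: S] (set_val : S -> R).
  apply: (measurability _ (RGenInftyO.measurableE R)) => _ [_ [a ->] <-].
  rewrite setTI (_ : _ @^-1` _ = \bigcup_(q : rat) [set x : S | ratr q <
    a /\ set_val x < ratr q :> R]).
    apply: bigcupT_measurable_rat => q.
    have [qa|qa] := ltP (ratr q) a.
      rewrite (_ : [set x | _] = [set x | set_val x < ratr q]).
        by apply: sub_sigma_algebra; exists q.
      by apply/seteqP; split => x /= => [[]|].
    by rewrite (_ : [set x | _] = set0)//; apply/seteqP; split => x // -[].
  apply/seteqP; split => x /=.
    rewrite in_itv/= => /rat_in_itvoo[q]; rewrite in_itv/= => /andP[xq qa].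
    by exists q.
  by move=> [q _ /= [qa xq]]; rewrite in_itv/= (lt_trans xq).
have := mval measurableT U (open_measurable oU).
by rewrite setTI.
Qed.

Lemma continuous_measurable01 (F : I01 -> I01) :
  continuous (F : unit_interval R -> unit_interval R) -> measurable_fun setT F.
Proof.
move=> cF; apply: measurability; first exact: measurable_borel01.
move=> _ [A oA <-]; rewrite setTI; apply: sub_sigma_algebra.
by move/continuousP : cF; exact.
Qed.

End unit_interval.
Arguments I01 R : clear implicits.

Section rays_suffice.
Context {R : realType}.
Implicit Types (u : I01 R -> R) (x : I01 R).

Lemma null_rays (C : R) (p : nat -> (I01 R -> R) -> R) :
  (forall m, L1_seminorm mu01 C (p m)) ->
  p ^~ (fun=> 1) @ \oo --> (0 : R) ->
  (forall a, p ^~ \1_[set x | set_val x < a] @ \oo --> (0 : R)) ->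
  forall u, bmeas u -> p ^~ u @ \oo --> (0 : R).
Proof.
move=> pC p1 pr; apply: (null_generators pC (@measurable_rays R)) => //.
  exact: setI_closed_rays.
by move=> _ [q _ <-].
Qed.

(** A constant sequence tends to 0 only if it vanishes: the principle that two
functionals bounded in L1 are equal if they agree on rays. *)
Lemma null_rays_eq0 (C : R) (p : (I01 R -> R) -> R) :
  L1_seminorm mu01 C p -> p (fun=> 1) = 0 ->
  (forall a, p \1_[set x | set_val x < a] = 0) ->
  forall u, bmeas u -> p u = 0.
Proof.
move=> pC p1 pr u bu.
have pu0 : (fun _ : nat => p u) @ \oo --> (0 : R).
  apply: (null_rays (fun=> pC)) => //; first by rewrite p1; exact: cvg_cst.
  by move=> a; rewrite pr; exact: cvg_cst.
by apply: (cvg_unique _ (cvg_cst (p u)) pu0); exact: norm_hausdorff.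
Qed.

End rays_suffice.

(** * Baire's theorem in complete metric spaces *)

Section baire.
Context (R : realType) (T : metricType R).

Definition seq_complete := forall u : nat -> T,
  (forall e, 0 < e -> exists N, forall m n, (N <= m)%N -> (N <= n)%N ->
    mdist (u m) (u n) < e) ->
  exists l, forall e, 0 < e -> exists N, forall n, (N <=
    n)%N -> mdist (u n) l < e.

(** Nested balls: the closed ball of step n + 1 lies in the open ball of step n
and in U n, and the radii tend to 0. *)
Lemma Baire_metric (U : (set T)^nat) : seq_complete ->
  (forall i, open (U i)) -> (forall i, dense (U i)) -> dense (\bigcap_i U i).
Proof.
move=> complete oU dU D D0 oD.
have shrink (V : set T) : open V -> V !=set0 -> forall n : nat,
    exists gr : T * R, [/\ 0 < gr.2, gr.2 < n.+1%:R^-1 &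
      forall h, mdist gr.1 h <= gr.2 -> V h].
  move=> oV [g Vg] n.
  have : nbhs g V by exact: open_nbhs_nbhs.
  move=> /nbhs_ballP[e /= e0 eV].
  exists (g, Num.min (e / 2) (n.+2%:R^-1)) => /=; split.
  - by rewrite lt_min divr_gt0//=.
  - by rewrite gt_min ltf_pV2 ?posrE// ltr_nat leqnn orbT.
  - move=> h; rewrite le_min => /andP[he _]; apply: eV; rewrite ballEmdist/=.
    by rewrite (le_lt_trans he)// ltr_pdivrMr// ltr_pMr// ltr1n.
have obll (g : T) r : open (ball g r).
  rewrite openE => h; rewrite ballEmdist/= => ghr; apply/nbhs_ballP.
  exists (r - mdist g h); rewrite /= ?subr_gt0// => k.
  rewrite !ballEmdist/= ltrBrDl; apply: le_lt_trans.
  exact: metric_triangle.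
have step (ngr : nat * (T * R)) : exists gr : T * R, 0 < ngr.2.2 ->
    [/\ 0 < gr.2, gr.2 < ngr.1.+1%:R^-1 &
      forall h, mdist gr.1 h <= gr.2 -> mdist ngr.2.1 h < ngr.2.2 /\ U ngr.1 h].
  case: ngr => n [g r] /=; have [r0|] := boolP (0 < r); last by exists (g, r).
  have [||gr [gr0 grn grV]] := shrink (ball g r `&` U n) _ _ n.
  - exact: openI.
  - by apply: dU => //; exists g; exact: ballxx.
  - exists gr => _; split=> // h /grV[]; by rewrite ballEmdist.
have [next nextP] := choice step.
have [gr0 [gr00 _ gr0D]] := shrink D oD D0 0%N.
pose fix s n := if n is m.+1 then next (m, s m) else gr0.
have s0 n : 0 < (s n).2.
  by elim: n => //= n IH; have [] := nextP (n, s n) IH.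
have sn n := nextP (n, s n) (s0 n).
have nest n m : (n <= m)%N -> forall h, mdist (s m).1 h <= (s m).2 ->
    mdist (s n).1 h <= (s n).2.
  elim: m => [|m IH]; first by rewrite leqn0 => /eqP->.
  rewrite leq_eqVlt => /predU1P[->//|]; rewrite ltnS => nm h hm.
  by apply: IH => //; have [_ _ /(_ h hm)[/ltW]] := sn m.
have self n : mdist (s n).1 (s n).1 <= (s n).2 by rewrite mdistxx ltW.
have [|l sl] := complete (fun n => (s n).1).
  move=> e e0; pose N := Num.truncn (2 / e).
  have eN : (N.+1)%:R^-1 < e / 2.
    rewrite -[X in _ < X]invrK ltf_pV2 ?posrE ?invr_gt0 ?divr_gt0//.
    by rewrite invf_div truncnS_gt.
  exists N.+1 => m n Nm Nn.
  have [_ rN _] := sn N.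
  have h k : (N < k)%N -> mdist (s N.+1).1 (s k).1 < e / 2.
    by move=> Nk; apply: le_lt_trans (lt_trans rN eN); exact: nest (self k).
  rewrite (splitr e) (le_lt_trans (metric_triangle _ (s N.+1).1 _))//.
  by rewrite ltrD//; [rewrite metric_sym|]; exact: h.
have inball n : mdist (s n).1 l <= (s n).2.
  apply/ler_addgt0Pr => e e0; have [N Nl] := sl e e0.
  have := Nl (maxn n N) (leq_maxr _ _) => /ltW h.
  rewrite (le_trans (metric_triangle _ (s (maxn n N)).1 _))// lerD//.
  exact: (nest _ _ (leq_maxl n N)).
exists l; split; first by apply: gr0D; exact: (inball 0%N).
by move=> n _; have [_ _ /(_ l (inball n.+1))[]] := sn n.
Qed.

End baire.

(** * Continuous maps preserving Lebesgue measure *)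

Section Clambda_toolbox.
Context {R : realType}.
Implicit Types (f g : Clambda R) (F : I01 R -> I01 R) (x y : I01 R).

Lemma continuous01P F :
  continuous (F : unit_interval R -> unit_interval R) <->
  forall x e, 0 < e -> exists2 d, 0 < d & forall y,
    `|set_val x - set_val y| < d -> `|set_val (F x) - set_val (F y)| < e.
Proof.
split=> [cF x e e0|cF x].
  have /cF/nbhs_ballP[d /= d0 dF] : nbhs (F x : unit_interval R) (ball (F x :
    unit_interval R) e).
    exact: nbhsx_ballx.
  by exists d => // y xy; exact: (dF y xy).
move=> V /nbhs_ballP[e /= e0 eV]; have [d d0 dF] := cF x e e0.
apply/nbhs_ballP; exists d => //= y xy; apply: eV; exact: (dF y xy).
Qed.

(** The Heine-Cantor theorem; compactness of the segment is used in the form: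
what holds near each point for all small d holds on the whole segment for all
small d. *)
Lemma uniform_continuity01 F :
  continuous (F : unit_interval R -> unit_interval R) ->
  forall e, 0 < e -> exists2 d, 0 < d & forall x y,
    `|set_val x - set_val y| < d -> `|set_val (F x) - set_val (F y)| < e.
Proof.
move=> /continuous01P cF e e0.
pose P (d z : R) := forall x y : I01 R, set_val x = z ->
  `|set_val x - set_val y| < d -> `|set_val (F x) - set_val (F y)| < e.
have := @segment_compact R 0 1 => /compact_near_coveringP.
move=> /(_ R (nbhs (0 : R)^'+) P _) [] .
  move=> z z01; have zK : set_val (proj01 z) = z by rewrite proj01K//;
    move: z01; rewrite /= in_itv.
  have e20 : 0 < e / 2 by rewrite divr_gt0.
  have [d d0 dF] := cF (proj01 z) _ e20.
  have d20 : 0 < d / 2 by rewrite divr_gt0.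
  exists (ball z (d / 2), [set r | r < d / 2]) => /=.
    split; first exact: nbhsx_ballx.
    exact: nbhs_right_lt.
  move=> [z' r] /= [zz' rd] x y xz' xy.
  rewrite (splitr e).
  apply: (le_lt_trans (ler_distD (set_val (F (proj01 z))) _ _)).
  rewrite ltrD//; [rewrite distrC|]; apply: dF; rewrite zK.
    by rewrite xz' (lt_trans zz')// ltr_pdivrMr// ltr_pMr// ltr1n.
  rewrite (splitr d) (le_lt_trans (ler_distD (set_val x) _ _))//.
  by rewrite ltrD//; [rewrite xz'|rewrite (lt_trans xy)].
move=> r /= r0 rP; have r20 : 0 < r / 2 by rewrite divr_gt0.
exists (r / 2) => // x y xy; apply: (rP (r / 2) _ _ (set_val x)) => //.
  by rewrite /= sub0r normrN gtr0_norm// ltr_pdivrMr// ltr_pMr// ltr1n.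
by have := val01 x; rewrite /= in_itv.
Qed.

Lemma lambda_fin_num (A : set (I01 R)) : measurable A -> (mu01 A =
  (lambda A)%:E).
Proof. by move=> mA; rewrite lambdaE fineK// fin_num_measure. Qed.

Lemma lambda_ge0 (A : set (I01 R)) : measurable A -> 0 <= lambda A.
Proof. by move=> mA; rewrite lambdaE fine_ge0. Qed.

Lemma lambda_le (A B : set (I01 R)) : measurable A -> measurable B -> A `<=` B
  ->
  lambda A <= lambda B.
Proof.
by move=> mA mB AB; rewrite -lee_fin -!lambda_fin_num//; apply: le_measure;
  rewrite ?inE.
Qed.

Lemma lambda_le1 (A : set (I01 R)) : measurable A -> lambda A <= 1.
Proof. by move=> mA; rewrite -lee_fin -lambda_fin_num// probability_le1. Qed.

Lemma measurable_ray F a : continuous (F : unit_interval R -> unit_interval R)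
  ->
  measurable ([set x | set_val (F x) < a] : set (I01 R)).
Proof.
move=> /continuousP cF; apply: sub_sigma_algebra.
exact: (cF _ (open_ray a)).
Qed.

Lemma preserving_rays F : measurable_fun setT F ->
  (forall a, 0 <= a <= 1 -> lambda [set x | set_val (F x) < a] = a) ->
  preserving mu01 F.
Proof.
move=> mF lF; split=> // A mA.
have mr a : measurable ([set x | set_val x < a] : set (I01 R)).
  by apply: sub_sigma_algebra; exact: open_ray.
have mFr a : measurable ([set x | set_val (F x) < a] : set (I01 R)).
  by have := mF measurableT _ (mr a); rewrite setTI.
rewrite -[LHS]/(pushforward mu01 F A).
apply: (measure_unique rays (fun=> [set x | set_val x < ratr 2])) => //.
- exact: measurable_rays.
- exact: setI_closed_rays.
- by move=> _; exists 2.
- apply/seteqP; split => // x _; exists 0%N => //=.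
  have /andP[_ x1] := val01 x; rewrite (le_lt_trans x1)//.
  by rewrite ratr_nat ltr1n.
- move=> _ [q _ <-].
  set a : R := ratr q.
  change (mu01 [set x : I01 R | set_val (F x) < a] =
    mu01 [set x : I01 R | set_val x < a]).
  have [a0|a0] := ltP a 0.
    suff empty (H : I01 R -> I01 R) : [set x | set_val (H x) < a] = set0.
      by rewrite (empty F) (empty id).
    apply/seteqP; split=> // x /=.
    by have /andP[/le_lt_trans h _] := val01 (H x) => /h; rewrite ltNge ltW.
  have [a1|a1] := leP a 1.
    rewrite !lambda_fin_num//; congr _%:E.
    rewrite (lF a) ?a0//.
    rewrite (_ : [set x | _] = [set x | set_val x \in `[0, a[ ]).
      by rewrite lambda_itv// subr0.
    by apply/seteqP; split => x /=; rewrite in_itv/=;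
      have /andP[-> _] := val01 x.
  suff full (H : I01 R -> I01 R) : [set x | set_val (H x) < a] = setT.
    by rewrite (full F) (full id).
  apply/seteqP; split=> // x _ /=.
  by have /andP[_ /le_lt_trans->] := val01 (H x).
- move=> _; change (mu01 [set x : I01 R | (set_val (F x) < ratr 2)%R] < +oo)%E.
  by rewrite (le_lt_trans (probability_le1 _ _)) ?ltry.
Qed.

Lemma Clambda_preserving_mu01 f : preserving mu01 (f : I01 R -> I01 R).
Proof.
have mf := continuous_measurable01 (@Clambda_continuous _ f).
split => // A mA.
change (mu01 (f @^-1` A) = mu01 A).
rewrite !lambda_fin_num//; first by rewrite -Clambda_preserving.
by have := mf measurableT _ mA; rewrite setTI.
Qed.

Lemma Clambda_of F : continuous (F : unit_interval R -> unit_interval R) ->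
  (forall a, 0 <= a <= 1 -> lambda [set x | set_val (F x) < a] = a) ->
  exists f : Clambda R, f = F :> (_ -> _).
Proof.
move=> cF lF; have mF := continuous_measurable01 cF.
have [_ pF] := preserving_rays mF lF.
have pF' A : borel01 A -> lambda A = lambda (F @^-1` A).
  by move=> mA; rewrite !lambdaE pF.
by exists (MkClambda cF pF').
Qed.

Lemma lambda_ray f a : 0 <= a <= 1 -> lambda [set x | set_val (f x) < a] = a.
Proof.
move=> /andP[a0 a1].
transitivity (lambda [set x : I01 R | set_val x \in `[0, a[ ]).
  rewrite (_ : [set x | _ \in _] = [set x | set_val x < a]).
    symmetry; apply: (Clambda_preserving f).
    by apply: sub_sigma_algebra; exact: open_ray.
  by apply/seteqP; split => x /=; rewrite in_itv/=; have /andP[-> _] := val01 x.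
by rewrite lambda_itv// subr0.
Qed.

Lemma Clambda_comp f g : exists h : Clambda R, h = f \o g :> (_ -> _).
Proof.
have ch : continuous (f \o g).
  move=> x; apply: (@continuous_comp _ _ _ g f).
    exact: (@Clambda_continuous _ g).
  exact: (@Clambda_continuous _ f).
have ph A : borel01 A -> lambda A = lambda ((f \o g) @^-1` A).
  move=> mA; rewrite (Clambda_preserving f)// (Clambda_preserving g)//.
  have [mf _] := Clambda_preserving_mu01 f.
  by have := mf measurableT A mA; rewrite setTI.
by exists (MkClambda ch ph).
Qed.

(** A uniform limit F of maps u n preserves the measure: if F is within e of u n,
then the set where F < a is squeezed between those where u n < a - e and where
u n < a + e, which have measures a - e and a + e. *)
Lemma Clambda_complete : seq_complete (Clambda R : metricType R).
Proof.
move=> u uC.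
have {}uC e : 0 < e -> exists N, forall m n, (N <= m)%N -> (N <= n)%N ->
    forall x, `|set_val (u m x) - set_val (u n x)| <= e.
  move=> /uC[N NP]; exists N => m n Nm Nn x.
  by rewrite (le_trans (le_rho _ _ x))// ltW//; exact: NP.
pose l x := limn (fun n => set_val (u n x)).
have lP e : 0 < e -> exists N, forall n, (N <= n)%N ->
    forall x, `|set_val (u n x) - l x| <= e.
  move=> e0; have [N NP] := uC e e0; exists N => n Nn x.
  have cvx : cvgn (fun n => set_val (u n x)).
    suff : cauchy_ex ((fun n => set_val (u n x)) @ \oo).
      by move=> /cauchy_exP; exact: cauchy_cvg.
    move=> d d0; have d20 : 0 < d / 2 by rewrite divr_gt0.
    have [M MP] := uC _ d20.
    exists (set_val (u M x)), M => // m /= Mm.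
    rewrite -ball_normE/=; apply: le_lt_trans (MP _ _ _ Mm _) _ => //.
    by rewrite ltr_pdivrMr// ltr_pMr// ltr1n.
  apply/ler_addgt0Pr => d d0.
  have /cvgrPdist_le/(_ _ d0)[M _ MP] := cvx.
  rewrite (le_trans (ler_distD (set_val (u (maxn N M) x)) _ _))//.
  rewrite lerD//; first by rewrite NP// leq_maxl.
  by rewrite distrC; apply: MP; rewrite /= leq_maxr.
have l01 x : 0 <= l x <= 1.
  apply/andP; split; apply/ler_addgt0Pr => e e0;
    have [N /(_ N (leqnn N) x)] := lP e e0;
    rewrite ler_norml; have := val01 (u N x); lra.
pose F x : I01 R := proj01 (l x).
have FE x : set_val (F x) = l x by rewrite proj01K.
have cF : continuous (F : unit_interval R -> unit_interval R).
  apply/continuous01P => x e e0.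
  have e40 : 0 < e / 4 by rewrite divr_gt0.
  have [N /(_ N (leqnn N)) NP] := lP _ e40.
  have [d d0 dP] := (continuous01P (u N)).1 (@Clambda_continuous _ (u N)) x _
    e40.
  exists d => // y /dP; rewrite !FE; have := NP x; have := NP y.
  by rewrite !ler_norml !ltr_norml; lra.
have mF a := measurable_ray a cF.
have mu' n a := measurable_ray a (@Clambda_continuous _ (u n)).
have [f fF] : exists f : Clambda R, f = F :> (_ -> _).
  apply: (Clambda_of cF) => a a01.
  apply/eqP; rewrite eq_le; apply/andP; split; apply/ler_addgt0Pr => e e0;
    have [N /(_ N (leqnn N)) NP] := lP _ e0.
  - have [ae1|ae1] := leP (a + e) 1; last first.
      by rewrite (le_trans (lambda_le1 _))// ltW.
    rewrite -[leRHS](@lambda_ray (u N)); last lra.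
    apply: lambda_le => // x /=; rewrite FE.
    by have := NP x; rewrite ler_norml; lra.
  - rewrite -lerBlDr; have [ae0|ae0] := leP 0 (a - e); last first.
      by rewrite (le_trans (ltW ae0))// lambda_ge0.
    rewrite -[leLHS](@lambda_ray (u N)); last lra.
    apply: lambda_le => // x /=; rewrite FE.
    by have := NP x; rewrite ler_norml; lra.
exists f => e e0; have e20 : 0 < e / 2 by rewrite divr_gt0.
have [N NP] := lP _ e20; exists N => n Nn.
apply: (@le_lt_trans _ _ (e / 2));
  last by rewrite ltr_pdivrMr// ltr_pMr// ltr1n.
by apply: rho_le => x; rewrite fF FE NP.
Qed.

End Clambda_toolbox.

(** * Uniform partitions *)

Section cells.
Context {R : realType}.
Implicit Types (x : I01 R) (A : set (I01 R)).

(** Half-open, hence pairwise disjoint; together they miss the point 1, which is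
negligible. *)
Definition cell (K q : nat) : set (I01 R) :=
  [set x | set_val x \in `[q%:R / K%:R, q.+1%:R / K%:R[ ].

Lemma measurable_itv01 (i : interval R) :
  measurable ([set x : I01 R | set_val x \in i]).
Proof.
have mv : measurable_fun [set: I01 R] (set_val : I01 R -> R).
  apply: (measurability _ (RGenInftyO.measurableE R)) => _ [_ [a ->] <-].
  rewrite setTI (_ : _ @^-1` _ = [set x | set_val x < a]).
    by apply: sub_sigma_algebra; exact: open_ray.
  by apply/seteqP; split => x /=; rewrite in_itv.
by have := mv measurableT _ (measurable_itv i); rewrite setTI.
Qed.

Lemma measurable_cell K q : measurable (cell K q).
Proof. exact: measurable_itv01. Qed.

Lemma measurable_below (a : R) : measurable ([set x : I01 R | set_val x < a]).
Proof. by apply: sub_sigma_algebra; exact: open_ray. Qed.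

Lemma lambda_cell K q : (q < K)%N -> lambda (cell K q) = K%:R^-1.
Proof.
move=> qK; have K0 : 0 < K%:R :> R by rewrite ltr0n (leq_ltn_trans _ qK).
rewrite lambda_itv.
- by rewrite -mulrBl -natr1 addrAC subrr add0r mul1r.
- by rewrite divr_ge0.
- by rewrite ler_pM2r ?invr_gt0// ler_nat.
- by rewrite ler_pdivrMr// mul1r ler_nat.
Qed.

Lemma lambdaU A B : measurable A -> measurable B -> A `&` B = set0 ->
  lambda (A `|` B) = lambda A + lambda B.
Proof.
move=> mA mB AB; have mAB := measurableU _ _ mA mB.
apply: EFin_inj; rewrite EFinD -!lambda_fin_num//.
by rewrite measureU.
Qed.

Lemma lambda_below1 A : measurable A -> lambda (A `&` [set x | set_val x <
  1]) = lambda A.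
Proof.
move=> mA; have mB := measurable_below 1.
have {2}-> : A = (A `&` [set x | set_val x <
  1]) `|` (A `\` [set x | set_val x < 1]).
  by rewrite setUIDK.
rewrite lambdaU; [|exact: measurableI|exact: measurableD|]; last first.
  by apply/seteqP; split => // x [[_ ?] [_]].
suff -> : lambda (A `\` [set x | set_val x < 1]) = 0 by rewrite addr0.
apply/eqP; rewrite eq_le lambda_ge0 ?andbT; last exact: measurableD.
rewrite (@le_trans _ _ (lambda [set x : I01 R | set_val x \in `[1, 1]]))//.
  apply: lambda_le; [exact: measurableD|exact: measurable_itv01|].
  move=> x [_ /negP]; rewrite -leNgt /= in_itv/= => ->.
  by have /andP[] := val01 x.
by rewrite lambda_itv ?subrr.
Qed.

Lemma lambda_sum_cells K A : (0 < K)%N -> measurable A ->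
  lambda A = \sum_(q < K) lambda (cell K q `&` A).
Proof.
move=> K0 mA; have KR : 0 < K%:R :> R by rewrite ltr0n.
suff H n : lambda (A `&` [set x | set_val x < n%:R / K%:R]) =
    \sum_(q < n) lambda (cell K q `&` A).
  by rewrite -H divff ?lt0r_neq0// lambda_below1.
elim: n => [|n IH].
  rewrite big_ord0 mul0r (_ : _ `&` _ = set0) ?lambdaE ?measure0//.
  apply/seteqP; split => // x [_ /=]; rewrite ltNge.
  by have /andP[->] := val01 x.
rewrite big_ord_recr/= -IH -lambdaU.
- congr lambda; apply/seteqP; split => x /=.
    move=> [Ax xn]; rewrite /cell/= in_itv/= xn andbT.
    by have [xn'|nx] := ltP (set_val x) (n%:R / K%:R); [left|right].
  rewrite /cell/= in_itv/= => -[[Ax xn]|[/andP[_ ->] ]]//; split=> //.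
  by rewrite (lt_le_trans xn)// ler_pM2r ?invr_gt0// ler_nat.
- by apply: measurableI => //; exact: measurable_below.
- by apply: measurableI => //; exact: measurable_cell.
- apply/seteqP; split => // x [[_ /= xn] [+ _]].
  by rewrite /cell/= in_itv/= leNgt xn.
Qed.

End cells.

(** * Zigzag maps *)

Section zigzag.
Context {R : realType}.

Lemma clamp01_lip (s t : R) : `|clamp01 s - clamp01 t| <= `|s - t|.
Proof.
rewrite /clamp01 !minEle !maxEle; do 2!case: (lerP 0 s) => ?;
  do 2!case: (lerP 0 t) => ?;
  repeat case: ifP => ?; rewrite ler_norml; have := ler_norm (s - t);
    have := ler_norm (t - s); rewrite distrC; lra.
Qed.

Lemma clamp01_ge1 (t : R) : 1 <= t -> clamp01 t = 1.
Proof. by move=> t1; rewrite /clamp01 max_r ?(le_trans ler01)// min_l. Qed.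

Lemma clamp01_le0 (t : R) : t <= 0 -> clamp01 t = 0.
Proof. by move=> t0; rewrite /clamp01 max_l// min_r. Qed.

(** A path with slopes 1 and -1 that turns back at every integer which is not a
multiple of M; as a sum of truncated lines it is visibly Lipschitz. *)
Definition zigzag_path (K M : nat) (y : R) : R :=
  \sum_(0 <= q < K) (-1) ^+ (q %% M)%N * clamp01 (y - q%:R).

Lemma zigzag_path_lip K M y z :
  `|zigzag_path K M y - zigzag_path K M z| <= K%:R * `|y - z|.
Proof.
rewrite /zigzag_path -sumrB (le_trans (ler_norm_sum _ _ _))//.
rewrite (@le_trans _ _ (\sum_(0 <= q < K) `|y - z|))//; last first.
  by rewrite sumr_const_nat subn0 mulr_natl.
apply: ler_sum => q _; rewrite -mulrBr normrM normrX normrN1 expr1n mul1r.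
rewrite (le_trans (clamp01_lip _ _))//.
by rewrite opprB addrA subrK.
Qed.

(** The height of [zigzag_path] at the integer q: for M odd, the laps of a
completed block add up to a climb of 1. *)
Lemma sum_alternating M q : odd M ->
  \sum_(0 <= p < q) (-1) ^+ (p %% M)%N = (q %/ M)%:R + (odd (q %% M))%:R :> R.
Proof.
move=> oM; have M0 : (0 < M)%N by case: M oM.
elim: q => [|q IH]; first by rewrite big_geq// div0n mod0n addr0.
rewrite big_nat_recr//= IH divnS// modnS natrD.
have [Mq|nMq] := boolP (M %| q.+1)%N.
  have -> : (q %% M = M.-1)%N.
    have [->|M1] := eqVneq M 1%N; first by rewrite modn1.
    by have := modn_pred M1 (ltn0Sn q); rewrite Mq.
  rewrite -signr_odd; have -> : odd M.-1 = false by move: oM;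
    rewrite -{1}(prednK M0)/= => /negbTE.
  by rewrite /= addr0 expr0 addrC addr0.
rewrite -signr_odd/= add0r -addrA; congr (_ + _).
by case: (odd _); rewrite /= ?expr0 ?expr1 ?add0r ?subrr.
Qed.

Lemma zigzag_path_lap K M q y : odd M -> (q < K)%N -> q%:R <= y <= q.+1%:R ->
  zigzag_path K M y = (q %/ M)%:R +
    (if odd (q %% M) then 1 - (y - q%:R) else y - q%:R).
Proof.
move=> oM qK /andP[qy yq].
rewrite /zigzag_path (@big_cat_nat _ _ _ q 0 K)//=; last exact: ltnW.
rewrite [X in _ + X]big_ltn//
  (eq_big_nat _ _ (F2 := fun p => (-1) ^+ (p %% M)%N)); last first.
  move=> p /andP[_ pq]; rewrite clamp01_ge1 ?mulr1//.
  by rewrite lerBrDr (le_trans _ qy)// addrC natr1 ler_nat.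
rewrite sum_alternating// [X in _ + (_ + X)]big1_seq; last first.
  move=> p; rewrite mem_index_iota => /andP[_ /andP[qp _]].
  by rewrite clamp01_le0 ?mulr0// subr_le0 (le_trans yq)// ler_nat.
rewrite addr0 clamp01_id; last by rewrite subr_ge0 qy/= lerBlDr addrC natr1.
rewrite -addrA -signr_odd; congr (_ + _).
by case: (odd _); rewrite /= ?expr0 ?expr1 ?mul1r ?add0r// mulN1r.
Qed.

Lemma sum_div (V : nmodType) N M (F : nat -> V) :
  \sum_(0 <= q < N * M) F (q %/ M)%N = \sum_(0 <= i < N) F i *+ M.
Proof.
have [->|M0] := posnP M.
  by rewrite muln0 big_geq// big1 // => i _; rewrite mulr0n.
elim: N => [|N IH]; first by rewrite mul0n !big_geq.
rewrite big_nat_recr//= -IH (@big_cat_nat _ _ _ (N *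
  M)) ?leq_mul2r ?leqnSn ?orbT//=.
congr (_ + _); rewrite (eq_big_nat _ _ (F2 := fun=> F N)).
  by rewrite sumr_const_nat mulSn addnK.
by move=> q /andP[q1 q2]; congr F; apply/eqP;
  rewrite eqn_leq leq_divRL// q1 -ltnS ltn_divLR// q2.
Qed.

Section zigzag_map.
Context (N M : nat) (N0 : (0 < N)%N) (oM : odd M).
Let K := (N * M)%N.
Let M0 : (0 < M)%N. Proof. by case: M oM. Qed.
Let K0 : (0 < K)%N. Proof. by rewrite muln_gt0 N0. Qed.
Let NR : 0 < N%:R :> R. Proof. by rewrite ltr0n. Qed.
Let MR : 0 < M%:R :> R. Proof. by rewrite ltr0n. Qed.
Let KR : 0 < K%:R :> R. Proof. by rewrite ltr0n. Qed.
Let KE : K%:R = N%:R * M%:R :> R. Proof. by rewrite natrM. Qed.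

Let z (x : R) : R := zigzag_path K M (K%:R * x) / N%:R.

Let lap_lt q : (q < K)%N -> (q %/ M < N)%N.
Proof. by move=> qK; rewrite ltn_divLR. Qed.

Let lap_base q : (q %/ M)%:R * M%:R <= q%:R :> R.
Proof. by rewrite -natrM ler_nat leq_trunc_div. Qed.

Let lap_top q : q.+1%:R <= (q %/ M).+1%:R * M%:R :> R.
Proof. by rewrite -natrM ler_nat ltn_ceil. Qed.

Let exists_lap (x : R) : 0 <= x <= 1 -> exists2 q, (q < K)%N &
  q%:R <= K%:R * x <= q.+1%:R.
Proof.
move=> /andP[x0 x1]; have Kx0 : 0 <= K%:R * x by rewrite mulr_ge0// ltW.
have [x_eq1|xn1] := eqVneq x 1.
  by exists K.-1; rewrite ?prednK// x_eq1 mulr1 lexx ler_nat leq_pred.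
have xlt1 : x < 1 by rewrite lt_neqAle xn1.
exists (Num.truncn (K%:R * x)).
  by rewrite truncn_lt_nat// gtr_pMr.
by have /andP[-> /ltW] := truncn_itv Kx0.
Qed.

Let z_lap (x : R) q : (q < K)%N -> q%:R <= K%:R * x <= q.+1%:R ->
  z x = ((q %/ M)%:R + (if odd (q %% M) then 1 - (K%:R * x - q%:R)
                        else K%:R * x - q%:R)) / N%:R.
Proof. by move=> qK qx; rewrite /z (zigzag_path_lap oM qK qx). Qed.

Let z_block (x : R) q : (q < K)%N -> q%:R <= K%:R * x <= q.+1%:R ->
  (q %/ M)%:R / N%:R <= z x <= (q %/ M).+1%:R / N%:R.
Proof.
move=> qK qx; rewrite (z_lap qK qx) -!natr1.
by move: qx; rewrite -!natr1 !ler_pM2r ?invr_gt0//; case: ifP => _; lra.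
Qed.

Let z01 x : 0 <= x <= 1 -> 0 <= z x <= 1.
Proof.
move=> /exists_lap[q qK qx]; have /andP[z1 z2] := z_block qK qx.
rewrite (le_trans _ z1) ?divr_ge0//= (le_trans z2)//.
by rewrite ler_pdivrMr// mul1r ler_nat lap_lt.
Qed.

Let Z (x : I01 R) : I01 R := proj01 (z (set_val x)).

Let ZE x : set_val (Z x) = z (set_val x).
Proof. by rewrite proj01K// z01// val01. Qed.

Let Z_continuous : continuous (Z : unit_interval R -> unit_interval R).
Proof.
apply/continuous01P => x e e0.
exists (e / (K%:R * K%:R)); first by rewrite divr_gt0// mulr_gt0.
move=> y xy; rewrite !ZE /z -mulrBl normrM normfV (ger0_norm (ltW NR)).
rewrite (@le_lt_trans _ _ (`|zigzag_path K M (K%:R * set_val x) -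
  zigzag_path K M (K%:R * set_val y)|))//.
  by rewrite ler_piMr// invf_le1// ler1n.
rewrite (le_lt_trans (zigzag_path_lip _ _ _ _))//
  -mulrBr normrM (ger0_norm (ltW KR)).
by rewrite mulrA -ltr_pdivlMl ?mulr_gt0// mulrC.
Qed.

Let Z_near x : `|set_val (Z x) - set_val x| <= N%:R^-1.
Proof.
rewrite ZE; have [q qK qx] := exists_lap (val01 x).
have /andP[z1 z2] := z_block qK qx.
have /andP[q1 q2] := qx.
have x1 : (q %/ M)%:R / N%:R <= set_val x.
  rewrite ler_pdivrMr// -(ler_pM2r MR) (le_trans (lap_base q))//
    (le_trans q1)//.
  by rewrite KE; lra.
have x2 : set_val x <= (q %/ M).+1%:R / N%:R.
  rewrite ler_pdivlMr// -(ler_pM2r MR) (le_trans _ (lap_top q))//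
    (le_trans _ q2)//.
  by rewrite KE; lra.
move: z1 z2 x1 x2; rewrite -natr1 mulrDl mul1r ler_norml; lra.
Qed.

(** On a lap, the map is affine onto a block of length M times that of the lap. *)
Let Z_lap q a : (q < K)%N ->
  lambda (cell K q `&` [set x | set_val (Z x) < a]) =
  lambda (cell N (q %/ M) `&` [set x | set_val x < a]) / M%:R.
Proof.
move=> qK; set i := (q %/ M)%N; have iN := lap_lt qK.
have iN1 : i.+1%:R / N%:R <= 1 :> R by rewrite ler_pdivrMr// mul1r ler_nat.
have i0 : 0 <= i%:R / N%:R :> R by rewrite divr_ge0.
have zx (x : I01 R) : cell K q x -> q%:R <= K%:R * set_val x < q.+1%:R.
  by rewrite /cell/= in_itv/= ler_pdivrMr// ltr_pdivlMr// mulrC.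
have xz (x : I01 R) : q%:R <= K%:R * set_val x < q.+1%:R -> cell K q x.
  by rewrite /cell/= in_itv/= ler_pdivrMr// ltr_pdivlMr// mulrC.
have [ia|ai] := ltP (i.+1%:R / N%:R) a.
  rewrite (_ : cell K q `&` _ = cell K q); last first.
    apply/seteqP; split => x /= => [[]//|cx]; split=> //.
    have /andP[x1 x2] := zx x cx.
    rewrite ZE (le_lt_trans _ ia)//.
    by have /andP[] := @z_block (set_val x) q qK (introT andP (conj x1 (ltW
      x2))).
  rewrite (_ : cell N i `&` _ = cell N i); last first.
    apply/seteqP; split => x /= => [[]//|cx]; split=> //.
    by move: cx; rewrite /cell/= in_itv/= => /andP[_ /lt_trans]; apply.
  by rewrite !lambda_cell// KE invfM.
have [ai'|ia] := leP a (i%:R / N%:R).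
  rewrite (_ : cell K q `&` _ = set0); last first.
    apply/seteqP; split => // x [cx /=].
    have /andP[x1 x2] := zx x cx.
    rewrite ZE ltNge (le_trans ai')//.
    by have /andP[] := @z_block (set_val x) q qK (introT andP (conj x1 (ltW
      x2))).
  rewrite (_ : cell N i `&` _ = set0); last first.
    apply/seteqP; split => // x [+ /=].
    rewrite /cell/= in_itv/= => /andP[ix _] xa.
    by have := le_lt_trans (le_trans ai' ix) xa; rewrite ltxx.
  by rewrite lambdaE measure0 mul0r.
rewrite (_ : cell N i `&` _ = [set x | set_val x \in `[i%:R / N%:R, a[ ]);
  last first.
  apply/seteqP; split => x; rewrite /cell/= !in_itv/=.
    by move=> [/andP[-> _] ->].
  by move=> /andP[-> xa]; rewrite xa (lt_le_trans xa).
rewrite lambda_itv//; [|exact: ltW|exact: le_trans iN1].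
pose c := (a - i%:R / N%:R) / M%:R.
have c0 : 0 < c by rewrite divr_gt0// subr_gt0.
have cE : c * K%:R = a * N%:R - i%:R.
  by rewrite /c KE; field; rewrite !lt0r_neq0.
have c1 : c <= K%:R^-1.
  rewrite -[leRHS]div1r ler_pdivlMr// cE lerBlDl natr1.
  by move: ai; rewrite ler_pdivlMr.
have qK1 : q.+1%:R / K%:R <= 1 :> R by rewrite ler_pdivrMr// mul1r ler_nat.
have qq : q.+1%:R / K%:R = q%:R / K%:R + K%:R^-1 :> R.
  by rewrite -natr1 mulrDl mul1r.
have [odd_lap|even_lap] := boolP (odd (q %% M)).
  rewrite (_ : cell K q `&` _ =
      [set x | set_val x \in `](q.+1%:R / K%:R - c), (q.+1%:R / K%:R)[ ]);
        last first.
    apply/seteqP; split => x /=.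
      move=> [cx]; have /andP[x1 x2] := zx x cx.
      rewrite ZE (z_lap qK) ?x1 ?(ltW x2)// odd_lap -/i ltr_pdivrMr// => zlt.
      rewrite in_itv/= -(ltr_pM2r KR) -[X in _ && X](ltr_pM2r KR) mulrBl !divfK
        ?lt0r_neq0//.
      rewrite cE [_ * K%:R]mulrC -natr1 in x2 *; apply/andP; split; lra.
    rewrite in_itv/= -(ltr_pM2r KR) -[X in _ && X](ltr_pM2r KR) mulrBl !divfK
      ?lt0r_neq0//.
    rewrite cE [set_val x * _]mulrC => /andP[x1 x2].
    have cx : cell K q x.
      apply/xz/andP; split=> //; move: ai x1; rewrite ler_pdivlMr// -!natr1;
        lra.
    split=> //; have /andP[x1' _] := zx x cx.
    rewrite ZE (z_lap qK) ?x1' ?(ltW x2)// odd_lap -/i ltr_pdivrMr//.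
    by move: x1; rewrite -natr1; lra.
  rewrite lambda_itv//; [by rewrite subKr| |by rewrite gerBl ltW].
  by rewrite subr_ge0 qq (le_trans c1)// lerDr divr_ge0.
rewrite (_ : cell K q `&` _ =
    [set x | set_val x \in `[(q%:R / K%:R), (q%:R / K%:R + c)[ ]); last first.
  apply/seteqP; split => x /=.
    move=> [cx]; have /andP[x1 x2] := zx x cx.
    rewrite ZE (z_lap qK) ?x1 ?(ltW x2)// (negbTE even_lap) -/i ltr_pdivrMr//
      => zlt.
    rewrite in_itv/= -(ler_pM2r KR) -[X in _ && X](ltr_pM2r KR) mulrDl !divfK
      ?lt0r_neq0//.
    by rewrite cE [_ * K%:R]mulrC; apply/andP; split; lra.
  rewrite in_itv/= -(ler_pM2r KR) -[X in _ && X](ltr_pM2r KR) mulrDl !divfK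
    ?lt0r_neq0//.
  rewrite cE [set_val x * _]mulrC => /andP[x1 x2].
  have x3 : K%:R * set_val x < q.+1%:R.
    by move: ai x2; rewrite ler_pdivlMr// -!natr1; lra.
  split; first by apply/xz; rewrite x1.
  rewrite ZE (z_lap qK) ?x1 ?(ltW x3)// (negbTE even_lap) -/i ltr_pdivrMr//.
  by lra.
rewrite lambda_itv.
- by rewrite addrAC subrr add0r.
- by rewrite divr_ge0.
- by rewrite lerDl ltW.
- by rewrite (le_trans _ qK1)// qq lerD2l.
Qed.

(** The map runs through each of the N blocks M times, with slopes M and -M.  As M
is odd, it leaves a block where it enters the next one, so that the map is
continuous although it preserves every block. *)
Lemma exists_zigzag : exists phi : Clambda R,
  (forall x, `|set_val (phi x) - set_val x| <= N%:R^-1) /\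
  (forall q a, (q < N * M)%N ->
     lambda (cell (N * M) q `&` [set x | set_val (phi x) < a]) =
     lambda (cell N (q %/ M) `&` [set x | set_val x < a]) / M%:R).
Proof.
have [phi phiE] : exists phi : Clambda R, phi = Z :> (_ -> _).
  apply: (Clambda_of Z_continuous) => a a01.
  rewrite (@lambda_sum_cells _ K)//; last exact: measurable_ray.
  rewrite (eq_bigr (fun q : 'I_K =>
    lambda (cell N (q %/ M) `&` [set x | set_val x < a]) / M%:R)); last first.
    by move=> q _; exact: Z_lap.
  pose c i := lambda (cell N i `&` [set x | set_val x < a]) / M%:R.
  rewrite -(big_mkord xpredT (fun q => c (q %/ M)%N)) sum_div big_mkord /c.
  rewrite (eq_bigr (fun i : 'I_N => lambda (cell N i `&` [set x | set_val x <
    a]))).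
    rewrite -lambda_sum_cells//; last exact: measurable_below.
    rewrite (_ : [set x | _] = [set x : I01 R | set_val x \in `[0, a[ ]).
      by have /andP[a0 a1] := a01; rewrite lambda_itv// subr0.
    by apply/seteqP; split => x /=; rewrite in_itv/=;
      have /andP[-> _] := val01 x.
  by move=> i _; rewrite -[_ *+ M]mulr_natr divfK// lt0r_neq0.
exists phi; rewrite phiE; split; first exact: Z_near.
exact: Z_lap.
Qed.

End zigzag_map.
End zigzag.

(** * Conditional expectations on uniform partitions *)

Section step_functions.
Context {R : realType}.
Implicit Types (u v h k : I01 R -> R) (c y : nat -> R) (x : I01 R).
Local Notation mean := (mean (@mu01 R)).

Definition step N c : I01 R -> R := fun x => \sum_(i < N) c i * \1_(cell N i) x.

Definition block_mean N u (i : nat) : R := N%:R * mean (fun x => u x *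
  \1_(cell N i) x).

(** The conditional expectation with respect to the partition into N cells, set to
0 at the point 1. *)
Definition cond_exp N u := step N (block_mean N u).

Lemma cell_inj N i j x : (0 < N)%N -> cell N i x -> cell N j x -> i = j.
Proof.
move=> N0; have NR : 0 < N%:R :> R by rewrite ltr0n.
rewrite /cell/= !in_itv/= !ler_pdivrMr// !ltr_pdivlMr//
  => /andP[i1 i2] /andP[j1 j2].
apply/eqP; rewrite eqn_leq; apply/andP.
by split; rewrite -ltnS -(ltr_nat R);
  [exact: le_lt_trans j2|exact: le_lt_trans i2].
Qed.

Lemma step_cell N c i x : (i < N)%N -> cell N i x -> step N c x = c i.
Proof.
move=> iN xi; rewrite /step (bigD1 (Ordinal iN))//= indicE mem_set// mulr1.
rewrite big1 ?addr0// => j ji; rewrite indicE;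
  case: (boolP (x \in _)) => [/set_mem xj|_].
  case/eqP: ji; apply/val_inj => /=; apply: (cell_inj _ xj xi).
  exact: leq_ltn_trans iN.
by rewrite mulr0.
Qed.

Lemma step_out N c x : (forall i, (i < N)%N -> ~ cell N i x) -> step N c x = 0.
Proof.
move=> xN; rewrite /step big1// => i _; rewrite indicE memNset ?mulr0//.
exact: xN.
Qed.

Lemma step_ind N (Q : R -> Prop) c x : (forall i, (i <
  N)%N -> Q (c i)) -> Q 0 -> Q (step N c x).
Proof.
move=> Qc Q0; have [[i iN xi]|nx] := pselect (exists2 i, (i < N)%N &
  cell N i x).
  by rewrite (step_cell _ iN xi); exact: Qc.
by rewrite step_out// => i iN xi; apply: nx; exists i.
Qed.

Lemma bmeas_step N c : bmeas (step N c).
Proof.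
apply: (@bmeas_sum _ _ _ _ (fun i x => c i * \1_(cell N i) x)) => i _.
by apply: bmeasZ; apply: bmeas_indic; exact: measurable_cell.
Qed.

Lemma mean_indic01 (A : set (I01 R)) : measurable A -> mean \1_A = lambda A.
Proof. exact: mean_indic. Qed.

Lemma bmeas_cell N i : bmeas (\1_(cell N i) : I01 R -> R).
Proof. by apply: bmeas_indic; exact: measurable_cell. Qed.

Lemma mean_step N c : mean (step N c) = \sum_(i < N) c i / N%:R.
Proof.
rewrite (@mean_sum _ _ _ _ _ (fun i x => c i * \1_(cell N i) x)); last first.
  by move=> i _; apply: bmeasZ; exact: bmeas_cell.
apply: eq_bigr => i _; rewrite meanZ; last exact: bmeas_cell.
by rewrite mean_indic01 ?lambda_cell//; exact: measurable_cell.
Qed.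

Lemma step_sqr N c x : step N c x ^+ 2 = step N (fun i => c i ^+ 2) x.
Proof.
have [[i iN xi]|nx] := pselect (exists2 i, (i < N)%N & cell N i x).
  by rewrite !(step_cell _ iN xi).
have xN i : (i < N)%N -> ~ cell N i x by move=> iN xi; apply: nx; exists i.
by rewrite !step_out// expr0n.
Qed.

Lemma block_mean_bound N u i : (0 < N)%N -> (i < N)%N -> bmeas u ->
  (forall x, `|u x| <= 1) -> `|block_mean N u i| <= 1.
Proof.
move=> N0 iN bu u1; have NR : 0 < N%:R :> R by rewrite ltr0n.
have bc := bmeas_cell N i.
rewrite /block_mean normrM normr_nat mulrC -ler_pdivlMr//
  mul1r -(lambda_cell iN).
rewrite -mean_indic01; last exact: measurable_cell.
rewrite (le_trans (norm_mean_le _ _))//; first exact: bmeasM.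
apply: le_mean => //; first by apply: bmeas_norm; exact: bmeasM.
by move=> x; rewrite normrM indicE; case: (_ \in _);
  rewrite ?normr1 ?normr0 ?mulr1 ?mulr0.
Qed.

Lemma cond_exp_bound N u x : (0 < N)%N -> bmeas u ->
  (forall x, `|u x| <= 1) -> `|cond_exp N u x| <= 1.
Proof.
move=> N0 bu u1; apply: (step_ind (Q := fun t => `|t| <= 1)) => [i iN|].
  exact: block_mean_bound.
by rewrite normr0.
Qed.

Lemma sum_cells_mean N u : (0 < N)%N -> bmeas u ->
  \sum_(i < N) mean (fun x => u x * \1_(cell N i) x) = mean u.
Proof.
move=> N0 bu.
have cellM i v : bmeas v -> bmeas (fun x => v x * \1_(cell N i) x).
  by move=> bv; apply: bmeasM => //; exact: bmeas_cell.
apply/eqP; rewrite -subr_eq0; apply/eqP.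
pose p v := `|\sum_(i < N) mean (fun x => v x * \1_(cell N i) x) - mean v|.
suff : p u = 0 by move=> /normr0_eq0.
have pC : L1_seminorm mu01 (N%:R + 1) p.
  split.
  - move=> v w bv bw; rewrite /p meanD// (eq_bigr (fun i : 'I_N =>
      mean (fun x => v x * \1_(cell N i) x) + mean (fun x => w x *
        \1_(cell N i) x))).
      by rewrite big_split/= opprD addrACA ler_normD.
    move=> i _; rewrite -meanD//; [|exact: cellM..].
    by apply: eq_mean => x; rewrite mulrDl.
  - move=> c v bv; rewrite /p meanZ// (eq_bigr (fun i : 'I_N =>
      c * mean (fun x => v x * \1_(cell N i) x))).
      by rewrite -mulr_sumr -mulrBr normrM.
    move=> i _; rewrite -meanZ; last exact: cellM.
    by apply: eq_mean => x; rewrite mulrA.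
  - move=> v bv; rewrite normr_ge0/= (le_trans (ler_normB _ _))//.
    rewrite mulrDl mul1r lerD//; last exact: norm_mean_le.
    rewrite (le_trans (ler_norm_sum _ _ _))//.
    rewrite (@le_trans _ _ (\sum_(i < N) mean (fun x => `|v x|)))//.
      apply: ler_sum => i _; rewrite (le_trans (norm_mean_le _ _))//;
        first exact: cellM.
      apply: le_mean; [by apply: bmeas_norm; exact: cellM|exact: bmeas_norm|].
      move=> x; rewrite normrM indicE.
      by case: (_ \in _); rewrite ?normr1 ?normr0 ?mulr1 ?mulr0.
    by rewrite sumr_const card_ord mulr_natl.
have p0 A : measurable A -> p \1_A = 0.
  move=> mA; rewrite /p mean_indic01// (lambda_sum_cells N0 mA).
  rewrite (eq_bigr (fun i : 'I_N => lambda (cell N i `&` A))) ?subrr ?normr0//.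
  move=> i _; rewrite -mean_indic01; last first.
    by apply: measurableI => //; exact: measurable_cell.
  by apply: eq_mean => x; rewrite indicI/= mulrC.
apply: (null_rays_eq0 pC) => // [|a]; last exact: p0 (measurable_below a).
rewrite -(p0 setT measurableT).
by congr p; apply/funext => x; rewrite indicE in_setT.
Qed.

Lemma mean_cond_exp N u : (0 < N)%N -> bmeas u -> mean (cond_exp N u) = mean u.
Proof.
move=> N0 bu; rewrite mean_step -[RHS](sum_cells_mean N0 bu).
apply: eq_bigr => i _; rewrite /block_mean mulrAC mulfV ?mul1r// .
by rewrite pnatr_eq0 -lt0n.
Qed.

(** Conditional expectations do not increase the L2 norm: Jensen's inequality in
each cell. *)
Lemma sum_sqr_block_mean N u : (0 < N)%N -> bmeas u ->
  \sum_(i < N) block_mean N u i ^+ 2 / N%:R <= mean (fun x => u x ^+ 2).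
Proof.
move=> N0 bu; have NR : 0 < N%:R :> R by rewrite ltr0n.
have buu : bmeas (fun x => u x ^+ 2) by exact: bmeasM.
rewrite -(sum_cells_mean N0 buu); apply: ler_sum => i _.
have bc := bmeas_cell N i.
have := @mean_cauchy_schwarz _ _ _ mu01 (fun x => u x *
  \1_(cell N i) x) \1_(cell N i).
have idem x : \1_(cell N i) x * \1_(cell N i) x = \1_(cell N i) x :> R.
  by rewrite indicE; case: (_ \in _); rewrite ?mulr1 ?mulr0.
have -> : mean (fun x => u x * \1_(cell N i) x * \1_(cell N i) x) =
    mean (fun x => u x * \1_(cell N i) x).
  by apply: eq_mean => x; rewrite -mulrA idem.
have -> : mean (fun x => (u x * \1_(cell N i) x) ^+ 2) =
    mean (fun x => u x ^+ 2 * \1_(cell N i) x).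
  by apply: eq_mean => x; rewrite exprMn [X in _ * X]expr2 idem.
have -> : mean (fun x => \1_(cell N i) x ^+ 2) = mean \1_(cell N i).
  by apply: eq_mean => x; rewrite expr2 idem.
rewrite mean_indic01 ?lambda_cell//; last exact: measurable_cell.
move=> /(_ (bmeasM bu bc) bc) h.
rewrite /block_mean; set m := mean _ in h *.
have -> : (N%:R * m) ^+ 2 / N%:R = m ^+ 2 * N%:R by field; rewrite lt0r_neq0.
by rewrite -ler_pdivlMr.
Qed.

End step_functions.

(** * The spectral gap of two interleaved partitions *)

Section contraction.
Context {R : realType}.
Implicit Types (u : I01 R -> R) (c y : nat -> R).
Local Notation mean := (mean (@mu01 R)).

(** The difference of the two sides is half of the sum of all (d i - d j) ^ 2. *)
Lemma sqr_sum_le (s : seq nat) (d : nat -> R) :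
  (\sum_(i <- s) d i) ^+ 2 <= (size s)%:R * \sum_(i <- s) d i ^+ 2.
Proof.
have : 0 <= \sum_(i <- s) \sum_(j <- s) (d i - d j) ^+ 2.
  by apply: sumr_ge0 => i _; apply: sumr_ge0 => j _; exact: sqr_ge0.
have -> : \sum_(i <- s) \sum_(j <- s) (d i - d j) ^+ 2 =
    2 * ((size s)%:R * \sum_(i <- s) d i ^+ 2) - 2 * (\sum_(i <- s) d i) ^+ 2.
  have rows : (size s)%:R * \sum_(i <- s) d i ^+ 2 =
    \sum_(i <- s) \sum_(j <- s) d i ^+ 2.
    rewrite mulr_sumr; apply: eq_bigr => i _.
    by rewrite big_const_seq count_predT iter_addr_0 mulr_natl.
  have cols : (size s)%:R * \sum_(i <- s) d i ^+ 2 =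
    \sum_(i <- s) \sum_(j <- s) d j ^+ 2.
    by rewrite rows exchange_big.
  rewrite mulr2n mulrDl mul1r {1}rows cols expr2 big_distrlr/= mulr_sumr.
  rewrite -big_split/= -sumrB; apply: eq_bigr => i _.
  rewrite mulr_sumr -big_split/= -sumrB; apply: eq_bigr => j _; ring.
by rewrite subr_ge0 ler_pM2l.
Qed.

(** Any difference y i - y j is a sum of at most N consecutive increments, and
y j, when y has mean zero, is the average over i of y j - y i. *)
Lemma discrete_poincare N y : \sum_(j < N.+1) y j = 0 ->
  \sum_(j < N.+1) y j ^+ 2 <=
    N%:R * N.+1%:R * \sum_(i < N) (y i.+1 - y i) ^+ 2.
Proof.
move=> y0; set D := \sum_(i < N) _.
have D0 : 0 <= D by apply: sumr_ge0 => i _; exact: sqr_ge0.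
have osc_le i j : (i <= j)%N -> (j <= N)%N -> (y j - y i) ^+ 2 <= N%:R * D.
  move=> ij jN; rewrite -telescope_sumr//.
  apply: (le_trans (sqr_sum_le _ _)); rewrite size_iota; apply: ler_pM => //.
  - by apply: sumr_ge0 => l _; exact: sqr_ge0.
  - by rewrite ler_nat (leq_trans (leq_subr _ _)).
  - rewrite /D -(big_mkord xpredT (fun i => (y i.+1 - y i) ^+ 2)).
    rewrite [leRHS](@big_cat_nat _ _ _ j)//= [X in _ <= X +
      _](@big_cat_nat _ _ _ i)//=.
    rewrite -addrA addrCA lerDl addr_ge0//; apply: sumr_ge0 => l _;
      exact: sqr_ge0.
have osc (i j : 'I_N.+1) : (y i - y j) ^+ 2 <= N%:R * D.
  case: (leqP i j) => ij; last by apply: osc_le; [exact: ltnW|rewrite -ltnS].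
  by rewrite -sqrrN opprB osc_le// -ltnS.
have NR : 0 < N.+1%:R :> R by [].
have pt (j : 'I_N.+1) : y j ^+ 2 <= N%:R * D.
  rewrite -(ler_pM2l NR).
  apply: (@le_trans _ _ (\sum_(i < N.+1) (y j - y i) ^+ 2)).
    rewrite (eq_bigr (fun i : 'I_N.+1 => y j ^+ 2 + (y i ^+ 2 - (2 * y j) *
      y i))); last first.
      by move=> i _; ring.
    rewrite big_split/= sumr_const card_ord -[y j ^+ 2 *+ _]mulr_natl lerDl
      sumrB -mulr_sumr y0 mulr0 subr0.
    by apply: sumr_ge0 => i _; exact: sqr_ge0.
  rewrite (le_trans (ler_sum _ (fun i _ => osc j i)))//.
  by rewrite sumr_const card_ord -[leLHS]mulr_natl.
rewrite (le_trans (ler_sum _ (fun j _ => pt j)))//.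
by rewrite sumr_const card_ord -[N%:R * D *+ _]mulr_natl; lra.
Qed.

Definition contraction_rate (N : nat) : R := 1 - (N%:R * N.+1%:R ^+ 2)^-1.

Lemma contraction_rate_itv N : (0 < N)%N -> 0 <= contraction_rate N < 1.
Proof.
move=> N0; have NN : 0 < N%:R * N.+1%:R ^+ 2 :>
  R by rewrite mulr_gt0 ?ltr0n ?exprn_gt0.
rewrite ltrBlDr ltrDl invr_gt0 NN andbT subr_ge0 invf_le1//.
by rewrite -natrX -natrM ler1n muln_gt0 N0 expn_gt0.
Qed.

(** By convexity, the square of the weighted average of y i and y i.+1 falls short
of the average of the squares by at least N / N.+1 ^ 2 times their squared
difference.  The averages of squares add up to the right-hand side without the
factor, and [discrete_poincare] bounds the total shortfall from below. *)
Lemma averaging_contracts N y : (0 < N)%N -> \sum_(j < N.+1) y j = 0 ->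
  \sum_(i < N) ((N%:R - i%:R) / N.+1%:R * y i + i.+1%:R / N.+1%:R *
    y i.+1) ^+ 2 / N%:R
  <= contraction_rate N * (\sum_(j < N.+1) y j ^+ 2 / N.+1%:R).
Proof.
move=> N0 y0.
have NR : 0 < N%:R :> R by rewrite ltr0n.
have N1 : 0 < N.+1%:R :> R by [].
set S := \sum_(j < N.+1) y j ^+ 2.
pose D := \sum_(i < N) (y i.+1 - y i) ^+ 2.
have SD : S <= N%:R * N.+1%:R * D := discrete_poincare y0.
have D0 : 0 <= D by apply: sumr_ge0 => i _; exact: sqr_ge0.
have weights : \sum_(i < N) ((N%:R - i%:R) * y i ^+ 2 + i.+1%:R *
  y i.+1 ^+ 2) = N%:R * S.
  rewrite big_split/=.
  have -> : \sum_(i < N) (N%:R - i%:R) * y i ^+ 2 = \sum_(j <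
    N.+1) (N%:R - j%:R) * y j ^+ 2.
    by rewrite big_ord_recr/= subrr mul0r addr0.
  have -> : \sum_(i < N) i.+1%:R * y i.+1 ^+ 2 = \sum_(j < N.+1) j%:R *
    y j ^+ 2.
    by rewrite big_ord_recl/= mul0r add0r.
  by rewrite -big_split/= mulr_sumr; apply: eq_bigr => j _; ring.
rewrite -!mulr_suml -/S.
apply: (@le_trans _ _ ((N%:R * S / N.+1%:R - N%:R / N.+1%:R ^+ 2 * D) / N%:R)).
  rewrite ler_pM2r ?invr_gt0// -weights mulr_suml mulr_sumr -sumrB.
  apply: ler_sum => i _.
  set q : R := i%:R.
  have -> : i.+1%:R = q + 1 :> R by rewrite /q natr1.
  have q0 : 0 <= q by [].
  have qN : q + 1 <= N%:R by rewrite /q natr1 ler_nat.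
  have -> : N.+1%:R = N%:R + 1 :> R by rewrite natr1.
  set n : R := N%:R in NR qN *.
  have n1 : n + 1 != 0 by rewrite lt0r_neq0// addr_gt0.
  set a := y i; set b := y i.+1.
  rewrite -subr_ge0.
  have -> : ((n - q) * a ^+ 2 + (q + 1) * b ^+ 2) / (n + 1) - n / (n +
    1) ^+ 2 * (b - a) ^+ 2 -
     ((n - q) / (n + 1) * a + (q + 1) / (n + 1) * b) ^+ 2 =
     (q * (n - (q + 1))) * ((b - a) / (n + 1)) ^+ 2 by field.
  by rewrite mulr_ge0 ?sqr_ge0// mulr_ge0// subr_ge0.
have n1 : N.+1%:R != 0 :> R by rewrite lt0r_neq0.
have n0 : N%:R != 0 :> R by rewrite lt0r_neq0.
have -> : (N%:R * S / N.+1%:R - N%:R / N.+1%:R ^+ 2 * D) / N%:R =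
    S / N.+1%:R - D / N.+1%:R ^+ 2.
  by field; rewrite nat1r n0 n1.
rewrite /contraction_rate mulrBl mul1r lerD2l lerN2.
rewrite [leRHS](_ : _ = (N%:R * N.+1%:R * D) / (N%:R * N.+1%:R ^+ 3));
  last first.
  by field; rewrite nat1r n0 n1.
rewrite [leLHS](_ : _ = S / (N%:R * N.+1%:R ^+ 3)); last first.
  by field; rewrite nat1r n0 n1.
by rewrite ler_pM2r// invr_gt0 mulr_gt0// exprn_gt0.
Qed.

(** The i-th of N equal cells meets only the i-th and i.+1-th of N.+1 equal cells,
in lengths proportional to N - i and i.+1. *)
Lemma block_mean_step N y i : (0 < N)%N -> (i < N)%N ->
  block_mean N (step N.+1 y) i =
  (N%:R - i%:R) / N.+1%:R * y i + i.+1%:R / N.+1%:R * y i.+1.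
Proof.
move=> N0 iN.
have NR : 0 < N%:R :> R by rewrite ltr0n.
have N1 : 0 < N.+1%:R :> R by [].
pose a : R := i%:R / N%:R; pose b : R := i.+1%:R / N.+1%:R;
  pose c : R := i.+1%:R / N%:R.
have iNR : i.+1%:R <= N%:R :> R by rewrite ler_nat.
have i0 : 0 <= i%:R :> R by [].
have a0 : 0 <= a by rewrite divr_ge0.
have ab : a <= b.
  by rewrite ler_pdivrMr// mulrAC ler_pdivlMr// -!natr1 in iNR *; nra.
have bc : b <= c.
  by rewrite ler_pdivrMr// mulrAC ler_pdivlMr// -!natr1 in iNR *; nra.
have c1 : c <= 1 by rewrite ler_pdivrMr// mul1r.
have la : i%:R / N.+1%:R <= a.
  by rewrite ler_pdivrMr// mulrAC ler_pdivlMr// -!natr1; nra.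
have cu : c <= i.+2%:R / N.+1%:R.
  by rewrite ler_pdivrMr// mulrAC ler_pdivlMr// -!natr1 in iNR *; nra.
pose A : set (I01 R) := [set x | set_val x \in `[a, b[ ].
pose B : set (I01 R) := [set x | set_val x \in `[b, c[ ].
rewrite /block_mean (eq_mean _ (v := fun x => y i * \1_A x + y i.+1 * \1_B x));
  last first.
  move=> x; have [ax|xa] := leP a (set_val x); last first.
    rewrite !indicE !memNset ?mulr0 ?addr0//; rewrite /A /B /cell/= in_itv/=.
    - by rewrite leNgt (lt_le_trans xa).
    - by rewrite leNgt xa.
    - by rewrite -/a leNgt xa.
  have [xb|bx] := ltP (set_val x) b.
    rewrite (@step_cell _ _ _ i); last 2 first.
    - by rewrite ltnS ltnW.
    - by rewrite /cell/= in_itv/= (le_trans la)//= .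
    rewrite !indicE (@mem_set _ A) ?(@memNset _ B) ?(@mem_set _ (cell N i))
      ?mulr0 ?addr0//.
    - by rewrite /cell/= in_itv/= ax /= (lt_le_trans xb).
    - by rewrite /B/= in_itv/= leNgt xb.
    - by rewrite /A/= in_itv/= ax.
  have [xc|cx] := ltP (set_val x) c.
    rewrite (@step_cell _ _ _ i.+1)//; last first.
      by rewrite /cell/= in_itv/= bx /= (lt_le_trans xc).
    rewrite !indicE (@mem_set _ B) ?(@memNset _ A) ?(@mem_set _ (cell N i))
      ?mulr0 ?add0r//.
    - by rewrite /cell/= in_itv/= ax.
    - by rewrite /A/= in_itv/= ltNge bx andbF.
    - by rewrite /B/= in_itv/= bx.
  rewrite !indicE !memNset ?mulr0 ?addr0//; rewrite /A /B /cell/= in_itv/=.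
  - by rewrite ltNge cx andbF.
  - by rewrite ltNge bx andbF.
  - by rewrite -/c ltNge cx andbF.
have mA : measurable A by exact: measurable_itv01.
have mB : measurable B by exact: measurable_itv01.
rewrite meanD; [|by apply: bmeasZ; exact: bmeas_indic..].
rewrite !meanZ; [|exact: bmeas_indic..].
have [b0 b1] := (le_trans a0 ab, le_trans bc c1).
rewrite !mean_indic01// !lambda_itv//.
rewrite /a /b /c -!natr1; field.
by rewrite natr1 !lt0r_neq0.
Qed.

(** A function of mean zero that is constant on the cells of both partitions
vanishes; this is the quantitative form of that remark. *)
Lemma cond_exp_contraction N u : (0 < N)%N -> bmeas u -> mean u = 0 ->
  mean (fun x => cond_exp N (cond_exp N.+1 u) x ^+ 2) <=
  contraction_rate N * mean (fun x => u x ^+ 2).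
Proof.
move=> N0 bu u0.
rewrite (eq_mean _ (@step_sqr _ _ _)) mean_step.
pose y := block_mean N.+1 u.
have y0 : \sum_(j < N.+1) y j = 0.
  by rewrite /y -mulr_sumr sum_cells_mean// u0 mulr0.
rewrite (eq_bigr (fun i : 'I_N => ((N%:R - i%:R) / N.+1%:R * y i +
    i.+1%:R / N.+1%:R * y i.+1) ^+ 2 / N%:R)); last first.
  by move=> i _; rewrite /cond_exp block_mean_step.
apply: (le_trans (averaging_contracts N0 y0)).
by rewrite ler_wpM2l ?sum_sqr_block_mean//;
  case/andP: (contraction_rate_itv N0).
Qed.

End contraction.

(** * Weak limits of composition operators *)

Section weak_limits.
Context {R : realType}.
Implicit Types (u v h k : I01 R -> R) (f g phi psi : Clambda R) (x : I01 R).
Local Notation mean := (mean (@mu01 R)).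
Local Notation weakly_null := (weakly_null (@mu01 R)).

(** Each of the N * M laps is spread evenly over the block which it traverses: all
that the weak limits require of a zigzag map. *)
Definition folds N M phi := forall q a, (q < N * M)%N ->
  lambda (cell (N * M) q `&` [set x | set_val (phi x) < a]) =
  lambda (cell N (q %/ M) `&` [set x | set_val x < a]) / M%:R.

Lemma bmeas_Clambda phi u : bmeas u -> bmeas (fun x => u (phi x)).
Proof. by move=> bu; apply: bmeas_comp => //;
  exact: (Clambda_preserving_mu01 phi).1. Qed.

Lemma mean_Clambda phi u : bmeas u -> mean (fun x => u (phi x)) = mean u.
Proof. by move=> bu; apply: mean_comp => //; exact: Clambda_preserving_mu01.
  Qed.

Lemma folds_mean N M phi q h : (q < N * M)%N -> folds N M phi -> bmeas h ->
  mean (fun x => h (phi x) * \1_(cell (N * M) q) x) =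
  mean (fun x => h x * \1_(cell N (q %/ M)) x) / M%:R.
Proof.
move=> qK fold bh; apply/eqP; rewrite -subr_eq0; apply/eqP/normr0_eq0;
  move: h bh.
have M0 : (0 < M)%N by case: M qK {fold} => //; rewrite muln0.
have iN : (q %/ M < N)%N by rewrite ltn_divLR.
have b1 h : bmeas h -> bmeas (fun x => h (phi x) * \1_(cell (N * M) q) x).
  by move=> bh; apply: bmeasM; [exact: bmeas_Clambda|exact: bmeas_cell].
have b2 h : bmeas h -> bmeas (fun x => h x * \1_(cell N (q %/ M)) x).
  by move=> bh; apply: bmeasM => //; exact: bmeas_cell.
have ray a : `|mean (fun x => \1_[set x | set_val x < a] (phi x) *
  \1_(cell (N * M) q) x) -
    mean (fun x => \1_[set x | set_val x < a] x *
      \1_(cell N (q %/ M)) x) / M%:R| = 0.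
  have mc i K := @measurable_cell R K i.
  have mb := @measurable_below R a.
  have mf : measurable ([set x | set_val (phi x) < a] : set (I01 R)).
    exact: (measurable_ray a (@Clambda_continuous _ phi)).
  have -> : mean (fun x => \1_[set x | set_val x < a] (phi x) * \1_(cell (N *
    M) q) x) =
      lambda (cell (N * M) q `&` [set x | set_val (phi x) < a]).
    rewrite -mean_indic01; last exact: measurableI.
    by apply: eq_mean => x; rewrite indicI /= mulrC.
  have -> : mean (fun x => \1_[set x | set_val x < a] x *
    \1_(cell N (q %/ M)) x) =
      lambda (cell N (q %/ M) `&` [set x | set_val x < a]).
    rewrite -mean_indic01; last exact: measurableI.
    by apply: eq_mean => x; rewrite indicI /= mulrC.
  by rewrite fold// subrr normr0.
pose p h := `|mean (fun x => h (phi x) * \1_(cell (N * M) q) x) -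
  mean (fun x => h x * \1_(cell N (q %/ M)) x) / M%:R|.
apply: (@null_rays_eq0 R 2 p); [| |exact: ray].
- rewrite /p; split.
  + move=> u v bu bv; rewrite (eq_mean _ (v := fun x =>
      u (phi x) * \1_(cell (N * M) q) x + v (phi x) * \1_(cell (N * M) q) x));
        last first.
      by move=> x; rewrite mulrDl.
    rewrite [X in _ - X / _](eq_mean _ (v := fun x =>
      u x * \1_(cell N (q %/ M)) x + v x * \1_(cell N (q %/ M)) x)); last first.
      by move=> x; rewrite mulrDl.
    rewrite !meanD; [|exact: b2|exact: b2|exact: b1|exact: b1].
    by rewrite mulrDl opprD addrACA ler_normD.
  + move=> c u bu; rewrite (eq_mean _ (v := fun x =>
      c * (u (phi x) * \1_(cell (N * M) q) x))); last first.
      by move=> x; rewrite mulrA.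
    rewrite [X in _ - X / _](eq_mean _ (v := fun x =>
      c * (u x * \1_(cell N (q %/ M)) x))); last first.
      by move=> x; rewrite mulrA.
    rewrite !meanZ; [|exact: b2|exact: b1].
    by rewrite -mulrA -mulrBr normrM.
  + move=> u bu; rewrite normr_ge0/= (le_trans (ler_normB _ _))//.
    have le1 (A : set (I01 R)) v : measurable A -> bmeas v ->
        `|mean (fun x => v x * \1_A x)| <= mean (fun x => `|v x|).
      move=> mA bv; have bA : bmeas (fun x => v x * \1_A x).
        by apply: bmeasM => //; exact: bmeas_indic.
      rewrite (le_trans (norm_mean_le _ bA))//; apply: le_mean;
        [exact: bmeas_norm..|].
      move=> x; rewrite normrM indicE.
      by case: (_ \in _); rewrite ?normr1 ?normr0 ?mulr1 ?mulr0.
    rewrite mulr2n mulrDl mul1r lerD//.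
      rewrite -(mean_Clambda phi (bmeas_norm bu)).
      by apply: le1; [exact: measurable_cell|exact: bmeas_Clambda].
    rewrite normrM normfV normr_nat ler_pdivrMr ?ltr0n//.
    rewrite (le_trans (le1 _ _ (measurable_cell _ _) bu))//.
    by rewrite ler_peMr ?ler1n// mean_ge0.
- rewrite (_ : (fun=> 1) = \1_[set x | set_val x < 2]); first exact: ray.
  apply/funext => x; rewrite indicE mem_set//=.
  by have /andP[_ x1] := val01 x; rewrite (le_lt_trans x1)// ltr1n.
Qed.


Lemma cell_refine N M q x : (0 < N)%N -> (0 < M)%N ->
  cell (N * M) q x -> cell N (q %/ M) x.
Proof.
move=> N0 M0; have NR : 0 < N%:R :> R by rewrite ltr0n.
have MR : 0 < M%:R :> R by rewrite ltr0n.
rewrite /cell/= !in_itv/= natrM !ler_pdivrMr ?mulr_gt0//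
  !ltr_pdivlMr ?mulr_gt0//.
rewrite mulrA => /andP[q1 q2]; apply/andP; split.
  rewrite -(ler_pM2r MR) (le_trans _ q1)//.
  by rewrite -natrM ler_nat leq_trunc_div.
rewrite -(ltr_pM2r MR) (lt_le_trans q2)//.
by rewrite -natrM ler_nat ltn_ceil.
Qed.

(** On a full lap, h m o phi m and the conditional expectation of h m have the
same integral.  A ray is a union of full laps and a part of one more lap, whose
measure is at most 1 / (N (2 m + 1)). *)
Lemma weak_folding N (phi : nat -> Clambda R) (h : nat -> I01 R -> R) : (0 <
  N)%N ->
  (forall m, folds N m.*2.+1 (phi m)) ->
  (forall m, bmeas (h m)) -> (forall m x, `|h m x| <= 1) ->
  weakly_null (fun m x => h m (phi m x) - cond_exp N (h m) x).
Proof.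
move=> N0 fold bh h1; rewrite /weakly_null.
pose D m x := h m (phi m x) - cond_exp N (h m) x.
have bE m : bmeas (cond_exp N (h m)) by exact: bmeas_step.
have bD m : bmeas (D m) by apply: bmeasB => //; exact: bmeas_Clambda.
have D2 m x : `|D m x| <= 2.
  rewrite (le_trans (ler_normB _ _))// (_ : 2 = 1 + 1)// lerD//.
  exact: cond_exp_bound.
have bDk m k : bmeas k -> bmeas (fun x => D m x * k x) by move=> bk;
  exact: bmeasM.
have lap0 m q : (q < N * m.*2.+1)%N -> mean (fun x => D m x * \1_(cell (N *
  m.*2.+1) q) x) = 0.
  move=> qK; set M := m.*2.+1; have iN : (q %/ M < N)%N by rewrite ltn_divLR.
  have bc := @bmeas_cell R (N * M) q.
  rewrite (eq_mean _ (v := fun x => h m (phi m x) * \1_(cell (N * M) q) x -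
      block_mean N (h m) (q %/ M) * \1_(cell (N * M) q) x)); last first.
    move=> x; rewrite mulrBl; congr (_ - _); rewrite indicE.
    case: (boolP (x \in _)) => [/set_mem xq|_]; last by rewrite !mulr0.
    by rewrite /cond_exp (step_cell _ iN)//; exact: cell_refine xq.
  rewrite meanB; [|by apply: bmeasM => //; exact: bmeas_Clambda|exact: bmeasZ].
  rewrite (folds_mean qK)// meanZ// mean_indic01 ?lambda_cell//;
    last exact: measurable_cell.
  rewrite /block_mean; set t := mean _; rewrite natrM invfM.
  by rewrite [N%:R * t]mulrC mulrA mulfK ?subrr// pnatr_eq0 -lt0n.
have laps0 m n : (n <= N * m.*2.+1)%N ->
    mean (fun x => D m x * \1_[set x | set_val x < n%:R / (N *
      m.*2.+1)%:R] x) = 0.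
  set K := (N * _)%N.
  have K0 : 0 < K%:R :> R by rewrite ltr0n muln_gt0 N0.
  elim: n => [_|n IH nK].
    rewrite -[RHS](mean_cst mu01); apply: eq_mean => x.
    rewrite indicE memNset ?mulr0//= mul0r => xlt0.
    by have /andP[] := val01 x; rewrite leNgt xlt0.
  rewrite (eq_mean _ (v := fun x => D m x * \1_[set x | set_val x <
    n%:R / K%:R] x +
      D m x * \1_(cell K n) x)); last first.
    move=> x; rewrite -mulrDr; congr (_ * _); rewrite !indicE -natrD;
      congr (_%:R).
    have nn : n%:R / K%:R <= n.+1%:R / K%:R :>
      R by rewrite ler_pM2r ?invr_gt0// ler_nat.
    have -> : (x \in cell K n) = (n%:R / K%:R <= set_val x) && (set_val x <
      n.+1%:R / K%:R).
      by apply/idP/idP => [/set_mem|xn]; [|apply/mem_set];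
        rewrite /cell/= in_itv.
    have ray a : (x \in [set x : I01 R | set_val x < a]) = (set_val x < a).
      by apply/idP/idP => [/set_mem|xa]; [|apply/mem_set].
    rewrite !ray leNgt; case: (ltP (set_val x) (n%:R / K%:R)) => //= xn.
    by rewrite (lt_le_trans xn nn).
  rewrite meanD; [|apply: bDk;
    exact: bmeas_indic (measurable_below _)|apply: bDk; exact: bmeas_cell].
  by rewrite IH ?add0r ?lap0// ltnW.
have p1 m : mean (fun x => D m x * 1) = 0.
  rewrite (eq_mean _ (v := D m)) => [|x]; last by rewrite mulr1.
  rewrite meanB; [|exact: bmeas_Clambda|by []].
  by rewrite mean_Clambda// mean_cond_exp// subrr.
have pr m a : `|mean (fun x => D m x * \1_[set x | set_val x < a] x)| <= 2 *
  m.+1%:R^-1.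
  set M := m.*2.+1; set K := (N * M)%N.
  have K0 : 0 < K%:R :> R by rewrite ltr0n muln_gt0 N0.
  have c0 : 0 <= 2 * m.+1%:R^-1 :> R by rewrite mulr_ge0.
  have [a0|a0] := ltP a 0.
    rewrite (eq_mean _ (v := fun=> 0)) ?mean_cst ?normr0// => x.
    rewrite indicE memNset ?mulr0//= => xa.
    by have /andP[] := val01 x; rewrite leNgt (lt_trans xa).
  have [a1|a1] := ltP 1 a.
    rewrite (eq_mean _ (v := fun x => D m x * 1)) ?p1 ?normr0// => x.
    rewrite indicE mem_set//=.
    by have /andP[_ x1] := val01 x; rewrite (le_lt_trans x1).
  have Ka0 : 0 <= K%:R * a by rewrite mulr_ge0// ltW.
  pose n := Num.truncn (K%:R * a).
  have /andP[n1 n2] := truncn_itv Ka0; rewrite -/n in n1 n2.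
  have nK : (n <= K)%N.
    by rewrite -(@ler_nat R) (le_trans n1)// ler_piMr// ltW.
  have na : n%:R / K%:R <= a by rewrite ler_pdivrMr// mulrC.
  pose B : set (I01 R) := [set x | set_val x \in `[n%:R / K%:R, a[ ].
  have mB : measurable B by exact: measurable_itv01.
  rewrite (eq_mean _ (v := fun x => D m x * \1_[set x | set_val x <
    n%:R / K%:R] x +
      D m x * \1_B x)); last first.
    move=> x; rewrite -mulrDr; congr (_ * _); rewrite !indicE -natrD;
      congr (_%:R).
    have -> : (x \in B) = (n%:R / K%:R <= set_val x) && (set_val x < a).
      by apply/idP/idP => [/set_mem|xn]; [|apply/mem_set]; rewrite /B/= in_itv.
    have ray b : (x \in [set x : I01 R | set_val x < b]) = (set_val x < b).
      by apply/idP/idP => [/set_mem|xb]; [|apply/mem_set].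
    rewrite !ray leNgt; case: (ltP (set_val x) (n%:R / K%:R)) => //= xn.
    by rewrite (lt_le_trans xn na).
  have bB : bmeas (fun x => D m x * \1_B x) by apply: bDk; exact: bmeas_indic.
  rewrite meanD//; last by apply: bDk; exact: bmeas_indic (measurable_below _).
  rewrite laps0// add0r (le_trans (norm_mean_le _ bB))//.
  apply: (@le_trans _ _ (mean (fun x => 2 * \1_B x))).
    apply: le_mean; [exact: bmeas_norm|by apply: bmeasZ; exact: bmeas_indic|].
    move=> x; rewrite normrM indicE.
    by case: (_ \in _); rewrite ?normr1 ?normr0 ?mulr1 ?mulr0.
  rewrite meanZ; last exact: bmeas_indic.
  rewrite ler_pM2l// mean_indic01// lambda_itv//.
  apply: (@le_trans _ _ K%:R^-1).
    rewrite lerBlDr -[X in X + _]mul1r -mulrDl nat1r ler_pdivlMr// mulrC.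
    exact: ltW.
  rewrite lef_pV2 ?posrE// ler_nat /K /M.
  by rewrite (leq_trans _ (leq_pmull _ N0))// ltnS -addnn leq_addr.
pose p m k := `|mean (fun x => D m x * k x)|.
suff p0 : forall k, bmeas k -> p ^~ k @ \oo --> (0 : R).
  by move=> k bk; apply/norm_cvg0P; exact: p0.
apply: (@null_rays R 2); rewrite {}/p.
- move=> m; split=> [u v bu bv|c u bu|u bu].
  + rewrite -/(D m) (eq_mean _ (v := fun x => D m x * u x + D m x * v x));
    last first.
      by move=> x; rewrite mulrDr.
    by rewrite meanD ?ler_normD//; exact: bDk.
  + rewrite (eq_mean _ (v := fun x => c * (D m x * u x))); last first.
      by move=> x; rewrite mulrCA.
    by rewrite meanZ ?normrM//; exact: bDk.
  + rewrite normr_ge0/= (le_trans (norm_mean_le _ (bDk m u bu)))//.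
    rewrite -meanZ; last exact: bmeas_norm.
    apply: le_mean; [by apply: bmeas_norm;
      exact: bDk|by apply/bmeasZ/bmeas_norm|].
    by move=> x; rewrite normrM ler_wpM2r.
- rewrite (_ : (fun m => _) = fun=> 0); first exact: cvg_cst.
  by apply/funext => m; rewrite p1 normr0.
- move=> a; apply: (@squeeze_cvgr _ _ _ _ (fun=> 0) (fun m => 2 * m.+1%:R^-1)).
  + by near=> m; rewrite normr_ge0/=; exact: pr.
  + exact: cvg_cst.
  + by rewrite -[X in _ --> X](mulr0 (2 : R)); apply: cvgMr;
    exact: cvg_harmonic.
Unshelve. all: by end_near. Qed.

Lemma weakly_nullD (r s : nat -> I01 R -> R) :
  (forall m, bmeas (r m)) -> (forall m, bmeas (s m)) ->
  weakly_null r -> weakly_null s -> weakly_null (fun m x => r m x + s m x).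
Proof.
move=> br bs r0 s0 k bk.
rewrite (_ : (fun m => _) = fun m => mean (fun x => r m x * k x) +
  mean (fun x => s m x * k x)).
  by rewrite -[X in _ --> X]addr0; apply: cvgD; [exact: r0|exact: s0].
apply/funext => m; rewrite -meanD; [|exact: bmeasM..].
by apply: eq_mean => x; rewrite mulrDl.
Qed.

Lemma cvg_sum0 n (F : nat -> nat -> R) : (forall i, F i @ \oo --> (0 : R)) ->
  (fun m => \sum_(i < n) F i m) @ \oo --> (0 : R).
Proof.
move=> F0; elim: n => [|n IH].
  rewrite (_ : (fun m => _) = fun=> 0); first exact: cvg_cst.
  by apply/funext => m; rewrite big_ord0.
rewrite (_ : (fun m => _) = fun m => \sum_(i < n) F i m + F n m).
  by rewrite -[X in _ --> X]addr0; exact: cvgD.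
by apply/funext => m; rewrite big_ord_recr.
Qed.

(** The conditional expectation depends only on the correlations of r m with the N
indicators of cells. *)
Lemma weakly_null_cond_exp N (r : nat -> I01 R -> R) : (0 < N)%N ->
  (forall m, bmeas (r m)) -> weakly_null r ->
  weakly_null (fun m => cond_exp N (r m)).
Proof.
move=> N0 br r0 k bk.
have bck i : bmeas (fun x => \1_(cell N i) x * k x) by apply: bmeasM => //;
  exact: bmeas_cell.
rewrite (_ : (fun m => _) = fun m => \sum_(i < N)
    block_mean N (r m) i * mean (fun x => \1_(cell N i) x * k x)); last first.
  apply/funext => m; rewrite (eq_mean _ (v := fun x => \sum_(i < N)
      block_mean N (r m) i * (\1_(cell N i) x * k x))); last first.
    by move=> x; rewrite mulr_suml; apply: eq_bigr => i _; rewrite mulrA.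
  rewrite (@mean_sum _ _ _ _ _ (fun i x => block_mean N (r m) i *
    (\1_(cell N i) x * k x))).
    by apply: eq_bigr => i _; rewrite meanZ.
  by move=> i _; exact: bmeasZ.
apply: (@cvg_sum0 N (fun i m => block_mean N (r m) i *
  mean (fun x => \1_(cell N i) x * k x))) => i.
rewrite -[X in _ --> X](mul0r (mean (fun x => \1_(cell N i) x * k x))).
apply: cvgMl; rewrite -[X in _ --> X](mulr0 (N%:R : R)).
by apply: cvgMr; apply: r0; exact: bmeas_cell.
Qed.

Lemma weak_folding_limit N (phi : nat -> Clambda R) (w : nat -> I01 R -> R) v :
  (0 < N)%N -> (forall m, folds N m.*2.+1 (phi m)) ->
  (forall m, bmeas (w m)) -> (forall m x, `|w m x| <= 1) -> bmeas v ->
  weakly_null (fun m x => w m x - v x) ->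
  weakly_null (fun m x => w m (phi m x) - cond_exp N v x).
Proof.
move=> N0 fold bw w1 bv wv.
rewrite (_ : (fun m x => _) = fun m x =>
  (w m (phi m x) - cond_exp N (w m) x) + cond_exp N (fun y => w m y - v y) x).
  apply: weakly_nullD.
  - by move=> m; apply: bmeasB; [exact: bmeas_Clambda|exact: bmeas_step].
  - by move=> m; exact: bmeas_step.
  - exact: weak_folding.
  - by apply: weakly_null_cond_exp => // m; exact: bmeasB.
apply/funext => m; apply/funext => x.
suff -> : cond_exp N (fun y => w m y - v y) x =
  cond_exp N (w m) x - cond_exp N v x.
  by rewrite addrA subrK.
rewrite /cond_exp /step -sumrB; apply: eq_bigr => i _; rewrite -mulrBl;
  congr (_ * _).
have bc := @bmeas_cell R N i.
rewrite /block_mean -mulrBr -meanB; [|exact: bmeasM..].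
by congr (_ * _); apply: eq_mean => x'; rewrite mulrBl.
Qed.

Lemma weak_limit_comp f (w : nat -> I01 R -> R) v :
  (forall m, bmeas (w m)) -> (forall m x, `|w m x| <= 1) ->
  bmeas v -> (forall x, `|v x| <= 1) ->
  weakly_null (fun m x => w m x - v x) ->
  weakly_null (fun m x => w m (f x) - v (f x)).
Proof.
move=> bw w1 bv v1 wv.
(* halved, to be bounded by 1 *)
pose r m x := 2^-1 * (w m x - v x).
have br m : bmeas (r m) by apply: bmeasZ; exact: bmeasB.
have r0 : weakly_null (fun m x => r m (f x)).
  apply: weakly_null_comp => //; first exact: Clambda_preserving_mu01.
    move=> m x; rewrite normrM gtr0_norm ?invr_gt0// mulrC ler_pdivrMr// mul1r.
    by rewrite (le_trans (ler_normB _ _))// (_ : 2 = 1 + 1)// lerD.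
  move=> k bk; rewrite (_ : (fun m => _) = fun m => 2^-1 *
    mean (fun x => (w m x - v x) * k x)).
    by rewrite -[X in _ --> X](mulr0 (2^-1 : R)); apply: cvgMr; exact: wv.
  apply/funext => m; rewrite -meanZ; last by apply: bmeasM => //; exact: bmeasB.
  by apply: eq_mean => x; rewrite mulrA.
move=> k bk; rewrite (_ : (fun m => _) = fun m => 2 * mean (fun x =>
  r m (f x) * k x)).
  by rewrite -[X in _ --> X](mulr0 (2 : R)); apply: cvgMr; exact: r0.
apply/funext => m; rewrite -meanZ; last by apply: bmeasM => //;
  exact: bmeas_Clambda.
by apply: eq_mean => x; rewrite /r mulrA mulrA mulfV// mul1r.
Qed.

End weak_limits.

(** * Decorrelated maps form open dense sets *)

Section generic.
Context {R : realType}.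
Implicit Types (u v h k : I01 R -> R) (f g phi psi : Clambda R) (x : I01 R) (A
  : set (I01 R)).
Local Notation mean := (mean (@mu01 R)).
Local Notation weakly_null := (weakly_null (@mu01 R)).

Definition centered A : I01 R -> R := fun x => \1_A x - lambda A.

Definition autocorrelation A f s : R :=
  mean (fun x => centered A (iter s f x) * centered A x).

Lemma bmeas_centered A : measurable A -> bmeas (centered A).
Proof. by move=> mA; apply: bmeasB; [exact: bmeas_indic|exact: bmeas_cst]. Qed.

Lemma centered_bound A x : measurable A -> `|centered A x| <= 1.
Proof.
move=> mA; rewrite /centered indicE.
have := lambda_ge0 mA; have := lambda_le1 mA.
by case: (_ \in _) => /=; rewrite ler_norml; lra.
Qed.

Lemma mean_centered A : measurable A -> mean (centered A) = 0.
Proof.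
move=> mA; rewrite meanB; [|exact: bmeas_indic|exact: bmeas_cst].
by rewrite mean_indic01// mean_cst subrr.
Qed.

Lemma bmeas_iter f s u : bmeas u -> bmeas (fun x => u (iter s f x)).
Proof.
move=> bu; apply: bmeas_comp => //.
exact: (preserving_iter s (Clambda_preserving_mu01 f)).1.
Qed.

(** The heart of the density argument: folding f at two interleaved scales makes
correlations decay.  The period p comes from the contraction rate and so depends
on N and e only, while i may be any positive integer. *)
Lemma folded_autocorrelation f N A e : (0 < N)%N -> measurable A -> 0 < e ->
  exists g : nat -> Clambda R,
    (forall m x, exists y, [/\ g m x = f y & `|set_val y - set_val x| <=
      2 / N%:R]) /\
    exists2 p, (0 < p)%N & forall i, (0 < i)%N ->
      \forall m \near \oo, `|autocorrelation A (g m) (i * p)| < e.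
Proof.
move=> N0 mA e0.
have folding K : (0 < K)%N -> exists phi : nat -> Clambda R, forall m,
    (forall x, `|set_val (phi m x) - set_val x| <=
      K%:R^-1) /\ folds K m.*2.+1 (phi m).
  move=> K0.
  have ex m : exists phi : Clambda R,
      (forall x, `|set_val (phi x) - set_val x| <=
        K%:R^-1) /\ folds K m.*2.+1 phi.
    by apply: exists_zigzag => //; rewrite /= odd_double.
  by have [F FP] := choice ex; exists F.
have [phi phiP] := folding N N0.
have [psi psiP] := folding N.+1 isT.
have [g gE] : exists g : nat -> Clambda R, forall m x, g m x =
  f (psi m (phi m x)).
  have ex m : exists g : Clambda R, forall x, g x = f (psi m (phi m x)).
    have [h1 h1E] := Clambda_comp f (psi m);
      have [h2 h2E] := Clambda_comp h1 (phi m).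
    by exists h2 => x; rewrite h2E/= h1E.
  by have [F FP] := choice ex; exists F.
have NR : 0 < N%:R :> R by rewrite ltr0n.
exists g; split.
  move=> m x; exists (psi m (phi m x)); split; first exact: gE.
  have [/(_ x) phi_near _] := phiP m;
    have [/(_ (phi m x)) psi_near _] := psiP m.
  rewrite (le_trans (ler_distD (set_val (phi m x)) _ _))//.
  rewrite mulr2n mulrDl mul1r lerD// (le_trans psi_near)//.
  by rewrite lef_pV2 ?posrE// ler_nat.
(* the weak limit, when m tends to infinity, of centered A o (g m) ^ n *)
pose fix V n := if n is n'.+1 then cond_exp N (cond_exp N.+1 (fun x => V n' (f
  x)))
                else centered A.
have bA := bmeas_centered mA.
have A1 x := centered_bound x mA.
have rate01 := @contraction_rate_itv R N N0.
have inv n : [/\ bmeas (V n), forall x, `|V n x| <= 1, mean (V n) = 0,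
    mean (fun x => V n x ^+ 2) <= contraction_rate N ^+ n &
    weakly_null (fun m x => centered A (iter n (g m) x) - V n x)].
  elim: n => [|n [bV V1 V0 V2 Vw]].
    split => //=.
    - exact: mean_centered.
    - rewrite expr0 -[leRHS](mean_cst mu01); apply: le_mean;
      [exact: bmeasM|exact: bmeas_cst|].
      by move=> x; rewrite -real_normK ?num_real// expr_le1.
    - move=> k bk; rewrite (_ : (fun m => _) = fun=> 0); first exact: cvg_cst.
      apply/funext => m; rewrite (eq_mean _ (v := fun=> 0)) ?mean_cst// => x.
      by rewrite subrr mul0r.
  have bVf : bmeas (fun x => V n (f x)) by exact: bmeas_Clambda.
  have bE : bmeas (cond_exp N.+1 (fun x => V n (f x))) by exact: bmeas_step.
  have Vf0 : mean (fun x => V n (f x)) = 0 by rewrite mean_Clambda.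
  have bw m : bmeas (fun x => centered A (iter n (g m) x)) by exact: bmeas_iter.
  have bwf m : bmeas (fun x => centered A (iter n (g m) (f x))).
    exact: (bmeas_Clambda f (bw m)).
  split.
  - exact: bmeas_step.
  - move=> x; apply: cond_exp_bound => // y.
    exact: cond_exp_bound.
  - by rewrite /= mean_cond_exp// mean_cond_exp.
  - rewrite exprS; apply: (le_trans (cond_exp_contraction N0 bVf Vf0)).
    rewrite ler_wpM2l//; first by have /andP[] := rate01.
    by rewrite (mean_Clambda f (u := fun x => V n x ^+ 2))//; exact: bmeasM.
  - rewrite (_ : (fun m x => _) = fun m x =>
        centered A (iter n (g m) (f (psi m (phi m x)))) - V n.+1 x); last first.
      by apply/funext => m; apply/funext => x; rewrite iterSr gE.
    apply: (weak_folding_limit (w := fun m x =>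
      centered A (iter n (g m) (f (psi m x))))) => //.
    + by move=> m; have [] := phiP m.
    + by move=> m; exact: (bmeas_Clambda (psi m) (bwf m)).
    apply: (weak_folding_limit (w := fun m x =>
      centered A (iter n (g m) (f x)))) => //.
    + by move=> m; have [] := psiP m.
    exact: (weak_limit_comp f (w := fun m x => centered A (iter n (g m) x))).
have e20 : 0 < e / 2 by rewrite divr_gt0.
have [rate0 rate1] := andP rate01.
have [p p0 pe] : exists2 p, (0 < p)%N & contraction_rate N ^+ p < (e / 2) ^+ 2.
  have rc : `|contraction_rate N : R| < 1 by rewrite ger0_norm.
  have /cvgrPdist_lt/(_ _ (exprn_gt0 2 e20))[p _ pP] := cvg_expr rc.
  exists p.+1 => //; have := pP p.+1 (leqnSn p).
  by rewrite sub0r normrN ger0_norm// exprn_ge0.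
exists p => // i i0; set s := (i * p)%N.
have [bV V1 V0 V2 Vw] := inv s.
have limit_small : `|mean (fun x => V s x * centered A x)| < e / 2.
  suff : `|mean (fun x => V s x * centered A x)| ^+ 2 < (e / 2) ^+ 2.
    by rewrite ltr_sqr// nnegrE ltW.
  rewrite real_normK ?num_real//.
  apply: le_lt_trans pe; apply: (le_trans (mean_cauchy_schwarz mu01 bV bA)).
  apply: (@le_trans _ _ (contraction_rate N ^+ s)).
    rewrite (le_trans _ V2)// ler_piMr//; first by apply: mean_ge0 => x;
      exact: sqr_ge0.
    have [_ _ _ + _] := inv 0%N; by rewrite expr0.
  by apply: ler_wiXn2l => //; [exact: ltW|rewrite leq_pmull].
have /cvgrPdist_lt/(_ _ e20) := Vw _ bA.
apply: filterS => m; rewrite sub0r normrN => dist_small.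
have bw : bmeas (fun x => centered A (iter s (g m) x)) by exact: bmeas_iter.
rewrite /autocorrelation (eq_mean _ (v := fun x =>
  (centered A (iter s (g m) x) - V s x) * centered A x + V s x * centered A x));
    last first.
  by move=> x; rewrite -mulrDl subrK.
rewrite meanD; [|by apply: bmeasM => //; exact: bmeasB|exact: bmeasM].
by rewrite (splitr e) (le_lt_trans (ler_normD _ _))// ltrD.
Qed.

Lemma lambda_itv_le (a b : R) : a <= b ->
  lambda [set x : I01 R | set_val x \in `[a, b[ ] <= b - a.
Proof.
move=> ab; rewrite -lee_fin -lambda_fin_num; last exact: measurable_itv01.
rewrite (_ : [set x | _] = set_val @^-1` `[a, b[)// mu01_preimage.
apply: (@le_trans _ _ (lebesgue_measure (`[a, b[%classic : set R))).
  by apply: le_measure => //; rewrite ?inE//; apply: measurableI.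
rewrite lebesgue_measure_itv/= lte_fin; case: ifP => // _.
by rewrite lee_fin subr_ge0.
Qed.

Lemma iter_close f s e : 0 < e -> exists2 d, 0 < d & forall g, rho f g < d ->
  forall x, `|set_val (iter s f x) - set_val (iter s g x)| < e.
Proof.
elim: s e => [|s IH] e e0.
  by exists 1 => // g _ x; rewrite subrr normr0.
have e20 : 0 < e / 2 by rewrite divr_gt0.
have [c c0 fc] := uniform_continuity01 (@Clambda_continuous _ f) e20.
have [d d0 dP] := IH c c0.
exists (Num.min d (e / 2)) => [|g]; first by rewrite lt_min d0.
rewrite lt_min => /andP[gd ge] x.
rewrite !iterS (splitr e) (le_lt_trans (ler_distD (set_val (f (iter s g x))) _
  _))//.
by rewrite ltrD//; [exact/fc/dP|rewrite (le_lt_trans (le_rho _ _ _))].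
Qed.

(** If f ^ s and g ^ s are within c of each other, they fall on different sides of
a only at points that f ^ s sends within c of a; these have measure at most 2 c,
since f ^ s preserves the measure. *)
Lemma autocorrelation_continuous (a : R) f s e : 0 < e ->
  exists2 d, 0 < d & forall g, rho f g < d ->
    `|autocorrelation [set x | set_val x < a] f s -
      autocorrelation [set x | set_val x < a] g s| < e.
Proof.
move=> e0; set A : set (I01 R) := [set x | _].
have mA : measurable A by exact: measurable_below.
have bA := bmeas_centered mA.
pose c := e / 4; have c0 : 0 < c by rewrite divr_gt0.
have [d d0 dP] := iter_close f s c0; exists d => // g /dP close.
pose B : set (I01 R) := [set x | set_val x \in `[a - c, a + c[ ].
have mB : measurable B by exact: measurable_itv01.
have bB : bmeas (\1_B : I01 R -> R) by exact: bmeas_indic.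
have bf (h : Clambda R) : bmeas (fun x => centered A (iter s h x) *
  centered A x).
  by apply: bmeasM => //; exact: bmeas_iter.
rewrite /autocorrelation -meanB//.
rewrite (le_lt_trans (norm_mean_le _ (bmeasB (bf f) (bf g))))//.
apply: (@le_lt_trans _ _ (mean (fun x => \1_B (iter s f x)))).
  apply: le_mean; [by apply/bmeas_norm/bmeasB|exact: (bmeas_iter f s bB)|].
  move=> x; rewrite -mulrBl normrM.
  apply: (@le_trans _ _ `|\1_A (iter s f x) - \1_A (iter s g x)|).
    rewrite /centered opprB addrA subrK ler_piMr//.
    exact: (centered_bound x mA).
  have ray y : \1_A y = (set_val y < a)%R%:R :> R.
    by rewrite indicE; congr (nat_of_bool _)%:R; apply/idP/idP => [/set_mem|ya];
      [|apply/mem_set].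
  rewrite !ray indicE.
  have [yB|yB] := boolP (iter s f x \in B).
    by case: (_ < _); case: (_ < _);
      rewrite ?subrr ?subr0 ?sub0r ?normrN ?normr0 ?normr1.
  have {}yB : ~ (a - c <= set_val (iter s f x) < a + c).
    by move=> h; move/negP: yB; apply; apply/mem_set; rewrite /B/= in_itv.
  have := close x; rewrite ltr_norml => /andP[h1 h2].
  case: (ltP (set_val (iter s f x)) a) => fa;
    case: (ltP (set_val (iter s g x)) a) => ga; rewrite ?subrr ?normr0//.
    by exfalso; apply: yB; apply/andP; split; lra.
  by exfalso; apply: yB; apply/andP; split; lra.
have -> : mean (fun x => \1_B (iter s f x)) = mean \1_B.
  by apply: mean_comp bB; exact/preserving_iter/Clambda_preserving_mu01.
rewrite mean_indic01//; apply: (@le_lt_trans _ _ ((a + c) - (a - c))).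
  by apply: lambda_itv_le; lra.
by rewrite /c; lra.
Qed.

Definition decorrelated A (j : nat) : set (Clambda R) :=
  [set f | exists p, forall i, (0 < i <= j)%N ->
     `|autocorrelation A f (i * p)| < j.+1%:R^-1].

Lemma dense_decorrelated A j : measurable A -> dense (decorrelated A j).
Proof.
move=> mA V [f Vf] oV.
have /nbhs_ballP[e /= e0 eV] : nbhs f V by exact: open_nbhs_nbhs.
have e20 : 0 < e / 2 by rewrite divr_gt0.
have [d d0 fd] := uniform_continuity01 (@Clambda_continuous _ f) e20.
pose N := (Num.truncn (2 / d)).+1.
have N0 : 0 < N%:R :> R by [].
have Nd : 2 / N%:R < d.
  by rewrite ltr_pdivrMr// mulrC -ltr_pdivrMr//; exact: truncnS_gt.
have [|g [gP [p p0 corr]]] := @folded_autocorrelation f N A j.+1%:R^-1 isT mA;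
  first by rewrite invr_gt0.
have : \forall m \near \oo, forall i : 'I_j.+1, (0 < i)%N ->
    `|autocorrelation A (g m) (i * p)| < j.+1%:R^-1.
  apply: filter_forall => i; have [i0|i0] := posnP i;
    first by apply: nearW => m.
  by apply: filterS (corr i i0).
move=> [m _ /(_ m (leqnn m)) gm].
exists (g m); split; last first.
  exists p => i /andP[i0 ij]; have := gm (Ordinal (ij : (i < j.+1)%N)) i0.
  by [].
apply: eV; rewrite ballEmdist/=; change (rho f (g m) < e).
apply: (@le_lt_trans _ _ (e / 2));
  last by rewrite ltr_pdivrMr// ltr_pMr// ltr1n.
apply: rho_le => x; have [y [-> xy]] := gP m x.
by apply/ltW/fd; rewrite distrC (le_lt_trans xy).
Qed.

Lemma open_decorrelated (a : R) j : open (decorrelated [set x | set_val x <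
  a] j).
Proof.
rewrite openE => f [p fp]; set A : set (I01 R) := [set x | _ ] in fp *.
have : forall i : 'I_j.+1, exists2 d, 0 < d & forall g, rho f g < d -> (0 <
  i)%N ->
    `|autocorrelation A g (i * p)| < j.+1%:R^-1.
  move=> i; have [i0|i0] := posnP i; first by exists 1.
  have := fp i; rewrite i0 -ltnS ltn_ord => /(_ isT) fi.
  have /(autocorrelation_continuous a f (i * p))[d d0 dP] :
    0 < j.+1%:R^-1 - `|autocorrelation A f (i * p)| by rewrite subr_gt0.
  exists d => // g /dP; rewrite distrC ltrBrDr => + _; apply: le_lt_trans.
  by rewrite -{1}(subrK (autocorrelation A f (i *
    p)) (autocorrelation A g _)) ler_normD.
move=> radii.
have [d dP] : exists d : 'I_j.+1 -> R, forall i, 0 < d i /\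
    forall g, rho f g < d i -> (0 < i)%N -> `|autocorrelation A g (i * p)| <
      j.+1%:R^-1.
  have ex (i : 'I_j.+1) : exists di : R, 0 < di /\ forall g, rho f g < di ->
      (0 < i)%N -> `|autocorrelation A g (i * p)| < j.+1%:R^-1.
    by have [di ? ?] := radii i; exists di.
  by have [F FP] := choice ex; exists F.
have : \forall g \near f, forall i : 'I_j.+1, rho f g < d i.
  apply: (@filter_forall _ _ (fun (i : 'I_j.+1) g => is_true (rho f g <
    d i)) (nbhs f) _) => i.
  apply/nbhs_ballP; exists (d i) => /=; first exact: (dP i).1.
  by move=> g; rewrite ballEmdist.
apply: filterS => g close; exists p => i /andP[i0 ij].
exact: (dP (Ordinal (ij : (i < j.+1)%N))).2.
Qed.

Lemma decorrelated_weakly_mixing f :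
  (forall (q : rat) j, decorrelated [set x | set_val x < ratr q] j f) ->
  weakly_mixing f.
Proof.
move=> fP A' B' mA' mB'.
pose A : set (I01 R) := A'; pose B : set (I01 R) := B'.
have mA : measurable A by [].
have mB : measurable B by [].
have pf := Clambda_preserving_mu01 f.
have bB : bmeas (\1_B : I01 R -> R) by exact: bmeas_indic.
have B1 x : `|\1_B x| <= 1 :> R by rewrite indicE; case: (_ \in _);
  rewrite ?normr1 ?normr0.
pose p n u := n%:R^-1 * \sum_(0 <= s < n)
  `|mean (fun x => u (iter s f x) * \1_B x) - mean u * mean \1_B|.
have pC n : L1_seminorm mu01 2 (p n) by exact: cesaro_seminorm.
suff : p ^~ \1_A @ \oo --> (0 : R).
  rewrite (_ : (p ^~ _) = (fun n => n%:R^-1 * \sum_(0 <= j < n)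
    `|lambda ((iter j f @^-1` A) `&` B) - lambda A * lambda B|))//.
  apply/funext => n; congr (_ * _); apply: eq_bigr => s _.
  have mfA : measurable (iter s f @^-1` A : set (I01 R)).
    by have := (preserving_iter s pf).1 measurableT A mA; rewrite setTI.
  rewrite !mean_indic01//; congr (`| _ - _|).
  rewrite -mean_indic01; last exact: measurableI.
  by apply: eq_mean => x; rewrite indicI.
apply: (null_generators pC (@measurable_rays R)).
- exact: setI_closed_rays.
- rewrite (_ : p ^~ _ = fun=> 0); first exact: cvg_cst.
  apply/funext => n; rewrite /p big1 ?mulr0// => s _.
  by rewrite mean_cst mul1r (@eq_mean _ _ _ _ _ \1_B) ?subrr ?normr0// => x;
    rewrite mul1r.
- move=> _ [q _ <-]; set C : set (I01 R) := [set x | _].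
  have mC : measurable C by exact: measurable_below.
  have bC := bmeas_centered mC.
  rewrite (_ : p ^~ _ = fun n => n%:R^-1 * \sum_(0 <= s < n)
      `|mean (fun x => centered C (iter s f x) * \1_B x)|).
    apply: cesaro_decorrelation => //; first by move=> x; exact: centered_bound.
    move=> j; have [r rP] := fP q j; exists r => i ij.
    by apply/ltW/rP.
  apply/funext => n; congr (_ * _); apply: eq_bigr => s _; congr (`| _ |).
  rewrite (mean_indic01 mC) -meanZ// -meanB.
  - by apply: eq_mean => x; rewrite -mulrBl.
  - apply: bmeasM => //; apply: (@bmeas_iter f s \1_C); exact: bmeas_indic.
  - exact: bmeasZ.
- exact: bmeas_indic.
Qed.

End generic.

Theorem theorem15 (R : realType) :
  exists G : set (Clambda R),
    dense G /\ Gdelta G /\ (forall f : Clambda R, G f -> weakly_mixing f).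
Proof.
(* the conditions are enumerated by pairs of a rational bound and an integer *)
pose U n : set (Clambda R) := if unpickle n is Some (q, j) then
  decorrelated [set x : I01 R | set_val x < ratr (q : rat)] (j : nat) else setT.
have oU n : open (U n).
  by rewrite /U; case: unpickle => [[q j]|];
    [exact: open_decorrelated|exact: openT].
have dU n : dense (U n).
  rewrite /U; case: unpickle => [[q j]|];
    first exact: dense_decorrelated (measurable_below _).
  by move=> V V0 oV; rewrite setIT.
exists (\bigcap_n U n); split;
  first exact: Baire_metric (@Clambda_complete R) oU dU.
split; first by exists U.
move=> f fU; apply: decorrelated_weakly_mixing => q j.
by have := fU (pickle (q, j)) I; rewrite /U pickleK.
Qed.
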